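(* Let $d\in\mathbb{N}_0$, $\boldsymbol{c}=(c_1,\ldots,c_d)\in(\mathbb{N}\setminus\{2\})^d$ with $c_1\ge3$ (if $d\ge1$), and $\boldsymbol{z}=(z_0,\ldots,z_d)\in\mathbb{C}^{d+1}$ with $|z_j|<1$. With $c_0=1$, $c_{d+1}=0$, $\delta_i=\delta(c_i)+\delta(c_{i+1})$, $k_{-1}=0$, $$G(\boldsymbol{c};\boldsymbol{z})=\frac{2}{\pi}\sum_{k_0\geq k_1\geq\cdots\geq k_d\geq1}\prod_{i=0}^{d}\frac{(-1)^{k_i\delta_i}(2k_i-1)^{\delta_i-1}}{(2k_i-1)^2-z_i^2}V_{k_{i-1},k_i}^{\#}(\{1\}^{c_i-3}).$$
   Context: For an index $\boldsymbol{s}=(s_1,\ldots,s_r)$ of positive integers with $s_1>1$ (or empty), the multiple $t$-star value is $t^{\star}(\boldsymbol{s})=\sum_{k_1\geq\cdots\geq k_r\geq1}\prod_{j=1}^r(2k_j-1)^{-s_j}$, $t^\star(\emptyset)=1$. $\{s\}^a$ denotes $s$ repeated $a$ times; for $a\le0$, $\{1\}^a$ is empty. $G(\boldsymbol{c};\boldsymbol{z})=\sum_{a_0,\ldots,a_d\geq0}t^{\star}(\{2\}^{a_0},c_1,\{2\}^{a_1},\ldots,c_d,\{2\}^{a_d})z_0^{2a_0}\cdots z_d^{2a_d}$. $\triangle(k,m)=0$ if $k=m$, $1$ otherwise. For an index $\boldsymbol{s}=(s_1,\ldots,s_r)$ and $k,m\in\mathbb{N}_0$: if $\boldsymbol{s}\ne\emptyset$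 and $k\ge m$, $V^{\#}_{k,m}(\boldsymbol{s})=\frac{2k-1}{2m-1}\sum_{k\geq l_1\geq\cdots\geq l_r\geq m}\frac{2^{\triangle(k,l_1)+\triangle(l_1,l_2)+\cdots+\triangle(l_r,m)}}{(2l_1-1)^{s_1}\cdots(2l_r-1)^{s_r}}$; otherwise $V^{\#}_{k,m}(\boldsymbol{s})=\left(2\cdot\frac{2k-1}{2m-1}\right)^{\triangle(k,m)}$. $\delta(0)=2$, $\delta(1)=1$, $\delta(c)=0$ for $c\ge3$. *)

(* Defs.v *)
From Stdlib Require Import Reals List Arith ZArith.
From Coquelicot Require Import Coquelicot.
Open Scope R_scope.

Fixpoint sumR1 (N : nat) (f : nat -> R) : R :=
  match N with O => 0 | S n => sumR1 n f + f (S n) end.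
Fixpoint sumRfrom (m M : nat) (f : nat -> R) : R :=
  match M with
  | O => if Nat.eqb m 0 then f 0%nat else 0
  | S n => sumRfrom m n f + (if Nat.leb m (S n) then f (S n) else 0)
  end.
Fixpoint sumC1 (N : nat) (f : nat -> C) : C :=
  match N with O => RtoC 0 | S n => Cplus (sumC1 n f) (f (S n)) end.
Fixpoint sumC0 (N : nat) (f : nat -> C) : C :=
  match N with O => f O | S n => Cplus (sumC0 n f) (f (S n)) end.
Fixpoint prodC0 (n : nat) (f : nat -> C) : C :=
  match n with O => f O | S n' => Cmult (prodC0 n' f) (f (S n')) end.
Fixpoint Cpow (x : C) (n : nat) : C :=
  match n with O => RtoC 1 | S n' => Cmult x (Cpow x n') end.

(* odd number 2k-1 as a real (equals -1 for k = 0) *)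
Definition odd2 (k : nat) : R := 2 * INR k - 1.

Fixpoint starsum (N : nat) (s : list nat) : R :=
  match s with
  | nil => 1
  | s1 :: s' => sumR1 N (fun k => / (odd2 k ^ s1) * starsum k s')
  end.

Definition tstar (s : list nat) : R := real (Lim_seq (fun N => starsum N s)).

Fixpoint gtail (c a : nat -> nat) (j n : nat) : list nat :=
  match n with
  | O => nil
  | S n' => c j :: repeat 2%nat (a j) ++ gtail c a (S j) n'
  end.
Definition Gidx (d : nat) (c a : nat -> nat) : list nat :=
  repeat 2%nat (a O) ++ gtail c a 1 d.

Fixpoint boxsum (N n : nat) (F : list nat -> C) : C :=
  match n with
  | O => F nil
  | S n' => sumC0 N (fun a => boxsum N n' (fun l => F (a :: l)))
  end.

Definition Gpartial (d : nat) (c : nat -> nat) (z : nat -> C) (N : nat) : C :=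
  boxsum N (S d) (fun l =>
    let a := fun i => nth i l 0%nat in
    Cmult (RtoC (tstar (Gidx d c a)))
          (prodC0 d (fun i => Cpow (z i) (2 * a i)))).

Definition tri (k m : nat) : nat := if Nat.eqb k m then 0%nat else 1%nat.

Fixpoint vsum (prev m : nat) (s : list nat) : R :=
  match s with
  | nil => 2 ^ tri prev m
  | s1 :: s' => sumRfrom m prev
                  (fun l => 2 ^ tri prev l / (odd2 l ^ s1) * vsum l m s')
  end.

Definition Vsharp (k m : nat) (s : list nat) : R :=
  match s with
  | nil => (2 * (odd2 k / odd2 m)) ^ tri k m
  | _ :: _ => if Nat.leb m k then odd2 k / odd2 m * vsum k m s
              else (2 * (odd2 k / odd2 m)) ^ tri k m
  end.

(* delta(0)=2, delta(1)=1, delta(c)=0 for c>=3 (c = 2 never occurs) *)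
Definition delta (c : nat) : nat :=
  match c with O => 2%nat | 1%nat => 1%nat | _ => 0%nat end.
Definition cext (d : nat) (c : nat -> nat) (i : nat) : nat :=
  if Nat.eqb i 0 then 1%nat else if Nat.leb i d then c i else 0%nat.
Definition deltai (d : nat) (c : nat -> nat) (i : nat) : nat :=
  (delta (cext d c i) + delta (cext d c (S i)))%nat.

Fixpoint chainsum (M n : nat) (F : list nat -> C) : C :=
  match n with
  | O => F nil
  | S n' => sumC1 M (fun k => chainsum k n' (fun l => F (k :: l)))
  end.

Definition factor (d : nat) (c : nat -> nat) (z : nat -> C) (i kprev k : nat) : C :=
  let di := deltai d c i in
  Cmult
    (Cdiv (RtoC ((-1) ^ (k * di) * powerRZ (odd2 k) (Z.of_nat di - 1)))
          (Cminus (RtoC (odd2 k ^ 2)) (Cpow (z i) 2)))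
    (RtoC (Vsharp kprev k (repeat 1%nat (cext d c i - 3)))).

Definition RHSpartial (d : nat) (c : nat -> nat) (z : nat -> C) (N : nat) : C :=
  Cmult (RtoC (2 / PI))
    (chainsum N (S d) (fun l =>
       prodC0 d (fun i =>
         factor d c z i (match i with O => O | S i' => nth i' l 0%nat end)
                        (nth i l 0%nat)))).

(* Main.v *)
Require Import Defs.
From Stdlib Require Import Reals List Arith ZArith.
From Coquelicot Require Import Coquelicot.
From Stdlib Require Import Lra Lia.

(** Put o_k = 2k-1 and let b(n,k) be, up to the factor (-1)^(k-1) o_k, the partial fraction
    coefficients of prod_(j <= n) (1 - z^2/o_j^2)^(-1).  They satisfy
    o_n^2 (b(n,k) - b(n-1,k)) = o_k^2 b(n,k), so prefixing an entry 2 to a truncated t-star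
    sum of the form sum_(k <= n) b(n,k) tau(k) replaces tau(k) by tau(k)/o_k^2.  Prefixing an
    entry c <> 2 is the same after the telescoping identity [bco_Vsharp], which is where
    V^# comes from.  Hence every truncated t-star value is an exact finite sum
    sum_(k <= n) b(n,k) tau(k), with tau(k) a nested sum as in the theorem.

    Since b(n,k) decreases in k and tends to 4/pi, Abel summation turns convergence of
    sum tau(k) into lim_n sum b(n,k) tau(k) = (4/pi) sum tau(k).  Summing over the box
    a_i <= N replaces the powers of z_i/o_k by truncated geometric series, and the sums over k
    are Cauchy uniformly in N, so the limits in N and in k can be exchanged. *)

(** * The finite identity *)

(** The shape of V^# is forced. The sequences n -> b(n,k) diagonalise the prefixing of a 2, with
    eigenvalue 1/o_k^2. Prefixing c multiplies by 1/o_n^c = o_n^(2-c)/o_n^2, so only o_n^(2-c)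
    b(n,m) has to be re-expanded in the b(n,k). For c = 1 this is one multiplication by o_n; for c
    >= 3 it is c - 2 divisions by o_n, each costing one summation over larger indices, and the c - 3
    intermediate indices are the string of ones in V^#. The powers of 2 record that such a sum is
    twice a telescoping sum minus its diagonal term. Two obstacles shape the limits. For d = 0 the
    series of tau(k) converges only conditionally, so b(n,k) -> 4/pi cannot be used by domination;
    monotonicity in k takes its place. And the two sides are truncated differently, by a_i <= N and
    by k_0 <= N, so both have to be recovered from one double sequence. *)

Lemma odd2_S (k : nat) : odd2 (S k) = odd2 k + 2.
Proof. unfold odd2; rewrite S_INR; ring. Qed.

Lemma odd2_ge1 (k : nat) : (1 <= k)%nat -> 1 <= odd2 k.
Proof. intros H; apply le_INR in H; simpl in H; unfold odd2; lra. Qed.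

Lemma odd2_neq0 (k : nat) : (1 <= k)%nat -> odd2 k <> 0.
Proof. intros H; apply odd2_ge1 in H; lra. Qed.

Lemma sumR1_ext (n : nat) (f g : nat -> R) :
  (forall k, (1 <= k <= n)%nat -> f k = g k) -> sumR1 n f = sumR1 n g.
Proof.
  induction n as [|n IH]; intros H; simpl; [reflexivity|].
  rewrite IH, (H (S n)) by (try lia; intros; apply H; lia); reflexivity.
Qed.

Lemma sumR1_scal (n : nat) (a : R) (f : nat -> R) :
  sumR1 n (fun k => a * f k) = a * sumR1 n f.
Proof. induction n as [|n IH]; simpl; [ring|rewrite IH; ring]. Qed.

Lemma sumR1_plus (n : nat) (f g : nat -> R) :
  sumR1 n (fun k => f k + g k) = sumR1 n f + sumR1 n g.
Proof. induction n as [|n IH]; simpl; [ring|rewrite IH; ring]. Qed.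

Lemma sumR1_eq0 (n : nat) (f : nat -> R) :
  (forall k, (1 <= k <= n)%nat -> f k = 0) -> sumR1 n f = 0.
Proof.
  intros H; rewrite (sumR1_ext n f (fun _ => 0)) by exact H.
  clear; induction n as [|n IH]; simpl; [ring|rewrite IH; ring].
Qed.

Lemma sumR1_swap (n m : nat) (f : nat -> nat -> R) :
  sumR1 n (fun k => sumR1 m (f k)) = sumR1 m (fun l => sumR1 n (fun k => f k l)).
Proof.
  induction n as [|n IH]; simpl; [now rewrite sumR1_eq0|].
  rewrite IH, <- sumR1_plus; reflexivity.
Qed.

Lemma sumR1_le (n : nat) (f g : nat -> R) :
  (forall k, (1 <= k <= n)%nat -> f k <= g k) -> sumR1 n f <= sumR1 n g.
Proof.
  induction n as [|n IH]; intros H; simpl; [lra|].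
  apply Rplus_le_compat; [apply IH; intros; apply H; lia|apply H; lia].
Qed.

Lemma sumR1_extend (m n : nat) (f : nat -> R) :
  (m <= n)%nat ->
  sumR1 m f = sumR1 n (fun k => if Nat.leb k m then f k else 0).
Proof.
  intros H; induction H as [|n H IH]; simpl.
  - apply sumR1_ext; intros k Hk.
    destruct (Nat.leb_spec k m); [reflexivity|lia].
  - rewrite IH. destruct m as [|m']; [ring|].
    destruct (Nat.leb_spec n m'); [lia|ring].
Qed.

Lemma sumR1_triangle_swap (n : nat) (f : nat -> nat -> R) :
  sumR1 n (fun k => sumR1 k (f k)) =
  sumR1 n (fun m => sumR1 n (fun k => if Nat.leb m k then f k m else 0)).
Proof.
  rewrite <- sumR1_swap; apply sumR1_ext; intros k Hk.
  apply (sumR1_extend k n); lia.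
Qed.

Lemma sumR1_indic_telescope (m n : nat) (t U : nat -> R) :
  (1 <= m <= S n)%nat ->
  (forall k, (m <= k <= n)%nat -> t k = U k - U (S k)) ->
  sumR1 n (fun k => if Nat.leb m k then t k else 0) = U m - U (S n).
Proof.
  induction n as [|n IH]; intros Hm Ht; cbn [sumR1].
  - replace m with 1%nat by lia; ring.
  - destruct (Nat.leb_spec m (S n)).
    + rewrite IH, Ht by (try lia; intros; apply Ht; lia); ring.
    + replace m with (S (S n)) by lia.
      rewrite sumR1_eq0; [ring|].
      intros k Hk; destruct (Nat.leb_spec (S (S n)) k); [lia|reflexivity].
Qed.

(** [tri] is 0 only on the diagonal, so every term but k = m carries the weight 2. This reduces the
    sums weighted by the powers of 2 in V^# to unweighted ones, which telescope. *)
Lemma sumR1_pow2_tri (m n : nat) (t : nat -> R) :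
  (1 <= m <= n)%nat ->
  sumR1 n (fun k => if Nat.leb m k then 2 ^ tri k m * t k else 0) =
  2 * sumR1 n (fun k => if Nat.leb m k then t k else 0) - t m.
Proof.
  intros [Hm Hn]; induction Hn as [|n Hn IH].
  - destruct m as [|m]; [lia|]; cbn [sumR1].
    assert (E : forall g : nat -> R,
      sumR1 m (fun k => if Nat.leb (S m) k then g k else 0) = 0).
    { intros g; apply sumR1_eq0; intros k Hk.
      destruct (Nat.leb_spec (S m) k); [lia|reflexivity]. }
    rewrite !E, Nat.leb_refl.
    unfold tri; rewrite Nat.eqb_refl; simpl; ring.
  - cbn [sumR1]; rewrite IH.
    destruct (Nat.leb_spec m (S n)); [|lia].
    unfold tri; destruct (Nat.eqb_spec (S n) m); [lia|simpl; ring].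
Qed.

Lemma sumRfrom_indic (m n : nat) (f : nat -> R) :
  (1 <= m)%nat ->
  sumRfrom m n f = sumR1 n (fun l => if Nat.leb m l then f l else 0).
Proof.
  intros Hm; induction n as [|n IH]; cbn [sumRfrom sumR1].
  - destruct (Nat.eqb_spec m 0); [lia|reflexivity].
  - rewrite IH; reflexivity.
Qed.

(** The first column b(n,1): partial products of Wallis' product for 4/pi, with factors o_j^2/(o_j^2
    - 1). The value 0 at n = 0 lets b(n,k) vanish for all k > n, including n = 0. *)
Fixpoint bco1 (n : nat) : R :=
  match n with
  | O => 0
  | S n' => match n' with
            | O => 1
            | S _ => bco1 n' * (odd2 n ^ 2 / (odd2 n ^ 2 - 1))
            end
  end.

(* For 1 <= k <= n this is ((2n-1)!!)^2 / (4^(n-1) (n-k)! (n+k-1)!), up to sign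
   and a factor 2k-1 the k-th partial fraction coefficient of
   prod_(j <= n) (1 - z^2/(2j-1)^2)^(-1); it vanishes for k > n. *)
Fixpoint bco (n k : nat) : R :=
  match k with
  | O => 0
  | S k' => match k' with
            | O => bco1 n
            | S _ => bco n k' * ((INR n - INR k') / (INR n + INR k'))
            end
  end.

Lemma bco_S (n k : nat) : (1 <= k)%nat ->
  (INR n + INR k) * bco n (S k) = (INR n - INR k) * bco n k.
Proof.
  intros Hk; destruct k as [|k]; [lia|].
  change (bco n (S (S k))) with
    (bco n (S k) * ((INR n - INR (S k)) / (INR n + INR (S k)))).
  field. pose proof (pos_INR n). rewrite S_INR; pose proof (pos_INR k); lra.
Qed.

Lemma bco_gt (n k : nat) : (n < k)%nat -> bco n k = 0.
Proof.
  intros H; induction H as [|k H IH].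
  - destruct n as [|n]; [reflexivity|].
    pose proof (bco_S (S n) (S n) ltac:(lia)) as E.
    rewrite Rminus_diag, Rmult_0_l in E.
    apply Rmult_integral in E; destruct E as [E|E]; [|exact E].
    rewrite S_INR in E; pose proof (pos_INR n); lra.
  - pose proof (bco_S n k ltac:(lia)) as E. rewrite IH, Rmult_0_r in E.
    apply Rmult_integral in E; destruct E as [E|E]; [|exact E].
    pose proof (pos_INR n); apply lt_INR in H. lra.
Qed.

Lemma bco1_SS (n : nat) :
  bco1 (S (S n)) = bco1 (S n) * (odd2 (S (S n)) ^ 2 / (odd2 (S (S n)) ^ 2 - 1)).
Proof. reflexivity. Qed.

(** Induction on k through o_(n+1)^2 - o_(k+1)^2 = 4(n-k)(n+1+k): the factor n+1+k is what [bco_S]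
    absorbs at n + 1, and n-k is what it produces at n. Without denominators the identity also
    covers k = n + 1, where both sides are 0. *)
Lemma bco_Sn (n k : nat) : (1 <= k)%nat ->
  (odd2 (S n) ^ 2 - odd2 k ^ 2) * bco (S n) k = odd2 (S n) ^ 2 * bco n k.
Proof.
  intros Hk; induction Hk as [|k Hk IH].
  - unfold bco. destruct n as [|n]; [unfold odd2; simpl; ring|].
    rewrite bco1_SS.
    assert (H : odd2 (S (S n)) ^ 2 - 1 <> 0).
    { unfold odd2; rewrite !S_INR; pose proof (pos_INR n); nra. }
    replace (odd2 1 ^ 2) with 1 by (unfold odd2; simpl; ring).
    field; exact H.
  - pose proof (bco_S (S n) k Hk) as E1. pose proof (bco_S n k Hk) as E2.
    pose proof (pos_INR n) as Hn. pose proof (le_INR _ _ Hk) as Hk'; simpl in Hk'.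
    rewrite S_INR in E1.
    apply Rmult_eq_reg_l with (INR n + INR k); [|lra].
    rewrite <- Rmult_assoc, (Rmult_comm (INR n + INR k)), Rmult_assoc.
    replace (odd2 (S n) ^ 2 - odd2 (S k) ^ 2)
      with (4 * (INR n - INR k) * (INR n + 1 + INR k))
      by (unfold odd2; rewrite !S_INR; ring).
    transitivity (4 * (INR n - INR k) * (INR n + INR k)
      * ((INR n + 1 + INR k) * bco (S n) (S k))); [ring|].
    rewrite E1.
    transitivity (odd2 (S n) ^ 2 * ((INR n + INR k) * bco n (S k))); [|ring].
    rewrite E2.
    transitivity ((INR n - INR k) * (odd2 (S n) ^ 2 * bco n k)); [|ring].
    rewrite <- IH. unfold odd2; rewrite S_INR; ring.
Qed.

Lemma bco_diff (n k : nat) : (1 <= k)%nat ->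
  bco (S n) k - bco n k = / odd2 (S n) ^ 2 * (odd2 k ^ 2 * bco (S n) k).
Proof.
  intros Hk. pose proof (bco_Sn n k Hk) as E.
  pose proof (odd2_neq0 (S n) ltac:(lia)) as Hn.
  apply Rmult_eq_reg_l with (odd2 (S n) ^ 2); [|now apply pow_nonzero].
  rewrite Rmult_minus_distr_l, <- E. field; exact Hn.
Qed.

(** The partial fraction coefficients (-1)^(k-1) o_k b(n,k) sum to 0 once the product has two
    factors: it is then O(z^(-4)) at infinity, so the z^(-2) terms cancel. At n = 1 the sum is
    -1. *)
Lemma bco_alt_odd_sum (n : nat) : (2 <= n)%nat ->
  sumR1 n (fun k => (-1) ^ k * odd2 k * bco n k) = 0.
Proof.
  intros Hn. pose proof (le_INR _ _ Hn) as Hn'; simpl in Hn'.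
  rewrite (sumR1_ext n _
    (fun k => if Nat.leb 1 k then (-1) ^ k * odd2 k * bco n k else 0)).
  2:{ intros k Hk; destruct (Nat.leb_spec 1 k); [reflexivity|lia]. }
  (* The factor k - 1 makes the antidifference vanish at k = 1, and b(n,n+1) = 0 kills the other
     end. *)
  rewrite (sumR1_indic_telescope 1 n _
    (fun k => (-1) ^ k * ((INR k - 1) / (INR n - 1)) * (INR n + INR k - 1) * bco n k)).
  - rewrite (bco_gt n (S n)) by lia. simpl. unfold Rdiv. ring.
  - lia.
  - intros k Hk. pose proof (bco_S n k ltac:(lia)) as E.
    rewrite S_INR.
    replace ((-1) ^ S k * ((INR k + 1 - 1) / (INR n - 1)) * (INR n + (INR k + 1) - 1)
               * bco n (S k))
      with (- (-1) ^ k * (INR k / (INR n - 1)) * ((INR n + INR k) * bco n (S k)))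
      by (simpl; field; lra).
    rewrite E. unfold odd2. field; lra.
Qed.

(** Induction on n: by [bco_diff] the increment of b(n,k)/o_k^2 is b(n+1,k)/o_(n+1)^2. Both sums may
    run to n + 1 because b(n,n+1) = 0. *)
Lemma bco_step (f tau : nat -> R) :
  (forall n, (1 <= n)%nat -> f n = sumR1 n (fun k => bco n k * tau k)) ->
  forall n, sumR1 n (fun m => / odd2 m ^ 2 * f m) =
            sumR1 n (fun k => bco n k * (tau k / odd2 k ^ 2)).
Proof.
  intros H n; induction n as [|n IH]; [reflexivity|].
  cbn [sumR1]. rewrite IH, H by lia.
  transitivity (sumR1 (S n) (fun k => bco n k * (tau k / odd2 k ^ 2))
    + sumR1 (S n) (fun k => / odd2 (S n) ^ 2 * (bco (S n) k * tau k))).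
  - rewrite sumR1_scal; cbn [sumR1]. rewrite (bco_gt n (S n)) by lia. ring.
  - rewrite <- sumR1_plus. apply (sumR1_ext (S n)); intros k Hk.
    pose proof (bco_diff n k ltac:(lia)) as E.
    replace (bco n k) with (bco (S n) k - / odd2 (S n) ^ 2 * (odd2 k ^ 2 * bco (S n) k))
      by (rewrite <- E; ring).
    field. split; apply odd2_neq0; lia.
Qed.

(** Partial fractions at z = 0, which give the empty index its weights. By [bco_diff] the increment
    in n is a multiple of the sum in [bco_alt_odd_sum], which applies since n + 1 >= 2. *)
Lemma bco_leibniz (n : nat) : (1 <= n)%nat ->
  sumR1 n (fun k => bco n k * (- (-1) ^ k / odd2 k)) = 1.
Proof.
  intros H; induction H as [|n H IH].
  - unfold odd2; simpl; field.
  - refine (eq_trans _ IH).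
    replace (sumR1 n (fun k => bco n k * (- (-1) ^ k / odd2 k)))
      with (sumR1 (S n) (fun k => bco n k * (- (-1) ^ k / odd2 k)))
      by (cbn [sumR1]; rewrite (bco_gt n (S n)) by lia; ring).
    apply Rminus_diag_uniq.
    transitivity (- / odd2 (S n) ^ 2 *
      sumR1 (S n) (fun k => (-1) ^ k * odd2 k * bco (S n) k)).
    + rewrite <- sumR1_scal.
      unfold Rminus.
      replace (- sumR1 (S n) (fun k => bco n k * (- (-1) ^ k / odd2 k)))
        with (sumR1 (S n) (fun k => -1 * (bco n k * (- (-1) ^ k / odd2 k))))
        by (rewrite sumR1_scal; ring).
      rewrite <- sumR1_plus. apply sumR1_ext; intros k Hk.
      pose proof (bco_diff n k ltac:(lia)) as E.
      replace (bco n k) with (bco (S n) k - / odd2 (S n) ^ 2 * (odd2 k ^ 2 * bco (S n) k))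
        by (rewrite <- E; ring).
      field. split; apply odd2_neq0; lia.
    + rewrite bco_alt_odd_sum by lia. ring.
Qed.

(** A mirror image of [bco_alt_sum]. The antidifference is (n+k-1) b(n,k), there with the sign
    (-1)^k and the divisor o_n; twice its value minus the diagonal term leaves 2(n+m-1) - o_m = o_n
    here and 2(n+m-1) - o_n = o_m there. *)
Lemma bco_odd_sum (m n : nat) : (1 <= m <= n)%nat ->
  sumR1 n (fun k => if Nat.leb m k then 2 ^ tri k m * (odd2 k * bco n k) else 0) =
  odd2 n * bco n m.
Proof.
  intros H. rewrite sumR1_pow2_tri by exact H.
  rewrite (sumR1_indic_telescope m n _ (fun k => (INR n + INR k - 1) * bco n k)).
  - rewrite (bco_gt n (S n)) by lia. unfold odd2; ring.
  - lia.
  - intros k Hk. pose proof (bco_S n k ltac:(lia)) as E. rewrite S_INR.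
    replace (INR n + (INR k + 1) - 1) with (INR n + INR k) by ring.
    rewrite E; unfold odd2; ring.
Qed.

Lemma bco_alt_sum (m n : nat) : (1 <= m <= n)%nat ->
  sumR1 n (fun k => if Nat.leb m k then 2 ^ tri k m * ((-1) ^ k * bco n k) else 0) =
  (-1) ^ m * odd2 m / odd2 n * bco n m.
Proof.
  intros H. pose proof (odd2_neq0 n ltac:(lia)) as Hn.
  rewrite sumR1_pow2_tri by exact H.
  rewrite (sumR1_indic_telescope m n _
    (fun k => (-1) ^ k * (INR n + INR k - 1) / odd2 n * bco n k)).
  - rewrite (bco_gt n (S n)) by lia. 
    apply Rmult_eq_reg_l with (odd2 n); [|exact Hn].
    field_simplify; [unfold odd2; ring|exact Hn|exact Hn].
  - lia.
  - intros k Hk. pose proof (bco_S n k ltac:(lia)) as E. rewrite S_INR.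
    replace ((-1) ^ S k * (INR n + (INR k + 1) - 1) / odd2 n * bco n (S k))
      with (- (-1) ^ k / odd2 n * ((INR n + INR k) * bco n (S k)))
      by (simpl; field; exact Hn).
    rewrite E.
    apply Rmult_eq_reg_l with (odd2 n); [|exact Hn].
    field_simplify; [unfold odd2; ring|exact Hn].
Qed.

(** Each entry 1 is one more division by o_n: with the sums exchanged, [bco_alt_sum] evaluates the
    sum over k >= l to (-1)^l o_l/o_n b(n,l), and o_l cancels the 1/o_l of [vsum]. The case r = 0 is
    already one division, hence the exponent [S r]. *)
Lemma bco_vsum_ones (r m n : nat) : (1 <= m <= n)%nat ->
  sumR1 n (fun k => if Nat.leb m k
                    then (-1) ^ k * bco n k * vsum k m (repeat 1%nat r) else 0) =
  (-1) ^ m * odd2 m / odd2 n ^ S r * bco n m.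
Proof.
  intros H. pose proof (odd2_neq0 n ltac:(lia)) as Hn.
  induction r as [|r IH].
  - simpl vsum.
    replace (odd2 n ^ 1) with (odd2 n) by ring.
    rewrite <- bco_alt_sum by exact H. apply sumR1_ext; intros k Hk.
    destruct (Nat.leb m k); ring.
  - transitivity (/ odd2 n * sumR1 n (fun k => if Nat.leb m k
                    then (-1) ^ k * bco n k * vsum k m (repeat 1%nat r) else 0)).
    2:{ rewrite IH. simpl; field; split; [now apply pow_nonzero|exact Hn]. }
    rewrite <- sumR1_scal.
    rewrite (sumR1_ext n _ (fun k => sumR1 k (fun l =>
      (if Nat.leb m l then 2 ^ tri k l * ((-1) ^ k * bco n k)
        * (/ odd2 l * vsum l m (repeat 1%nat r)) else 0)))).
    2:{ intros k Hk. cbn [repeat vsum]. rewrite sumRfrom_indic by lia.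
        destruct (Nat.leb_spec m k).
        - rewrite <- sumR1_scal. apply sumR1_ext; intros l Hl.
          destruct (Nat.leb m l); [|ring]. rewrite pow_1. unfold Rdiv. ring.
        - symmetry; apply sumR1_eq0; intros l Hl.
          destruct (Nat.leb_spec m l); [lia|reflexivity]. }
    rewrite sumR1_triangle_swap. apply sumR1_ext; intros l Hl.
    destruct (Nat.leb m l).
    + transitivity (/ odd2 l * vsum l m (repeat 1%nat r) * sumR1 n
        (fun k => if Nat.leb l k then 2 ^ tri k l * ((-1) ^ k * bco n k) else 0)).
      * rewrite <- sumR1_scal. apply sumR1_ext; intros k Hk.
        destruct (Nat.leb l k); ring.
      * rewrite bco_alt_sum by lia. field.
        split; [exact Hn|apply odd2_neq0; lia].
    + rewrite Rmult_0_r. apply sumR1_eq0; intros k Hk.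
      destruct (Nat.leb l k); reflexivity.
Qed.

(** * The factors of the theorem and the prefixing of an entry c *)

Lemma Vsharp_vsum (k m : nat) (s : list nat) : (1 <= m <= k)%nat ->
  Vsharp k m s = odd2 k / odd2 m * vsum k m s.
Proof.
  intros H. destruct s as [|x s]; unfold Vsharp.
  - simpl vsum. unfold tri. destruct (Nat.eqb_spec k m) as [->|].
    + simpl. field. apply odd2_neq0; lia.
    + simpl. field. apply odd2_neq0; lia.
  - destruct (Nat.leb_spec m k); [reflexivity|lia].
Qed.

(* The two halves of the sign-and-power factor with exponent
   delta_i = delta(c_i) + delta(c_(i+1)): see [kap_lam]. *)
Definition kap (c k : nat) : R :=
  (-1) ^ (k * (1 + delta c)) * powerRZ (odd2 k) (Z.of_nat (delta c) - 1).
Definition lam (c k : nat) : R := (-1) ^ (k * (1 + delta c)) * odd2 k ^ delta c.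

Lemma pow_m1_even (k j : nat) : (-1) ^ (k * (2 * j)) = 1.
Proof. replace (k * (2 * j))%nat with (2 * (k * j))%nat by lia. apply pow_1_even. Qed.

(** Each half carries an additional factor (-1)^k, and the two cancel. They make [kap 1] and [lam 1]
    free of signs and give [lam c] the sign (-1)^k for c >= 3, as [bco_odd_sum] and [bco_alt_sum]
    require. *)
Lemma kap_lam (c c' k : nat) : (1 <= k)%nat ->
  (-1) ^ (k * (delta c + delta c')) *
    powerRZ (odd2 k) (Z.of_nat (delta c + delta c') - 1) = lam c k * kap c' k.
Proof.
  intros Hk. unfold lam, kap.
  replace (Z.of_nat (delta c + delta c') - 1)%Z
    with (Z.of_nat (delta c) + (Z.of_nat (delta c') - 1))%Z by lia.
  rewrite powerRZ_add, <- pow_powerRZ by (apply odd2_neq0; lia).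
  assert (E : (-1) ^ (k * (1 + delta c)) * (-1) ^ (k * (1 + delta c')) =
              (-1) ^ (k * (delta c + delta c'))).
  { rewrite <- pow_add.
    replace (k * (1 + delta c) + k * (1 + delta c'))%nat
      with (k * (delta c + delta c') + k * (2 * 1))%nat by lia.
    rewrite pow_add, pow_m1_even; ring. }
  rewrite <- E; ring.
Qed.

Lemma kap1 (k : nat) : kap 1 k = 1.
Proof. unfold kap; cbn [delta]. change (1 + 1)%nat with (2 * 1)%nat. rewrite pow_m1_even. simpl. ring. Qed.

Lemma lam1 (k : nat) : lam 1 k = odd2 k.
Proof. unfold lam; cbn [delta]. change (1 + 1)%nat with (2 * 1)%nat. rewrite pow_m1_even. ring. Qed.

Lemma delta_ge3 (c : nat) : (3 <= c)%nat -> delta c = 0%nat.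
Proof. intros H; destruct c as [|[|[|c]]]; try lia; reflexivity. Qed.

Lemma kap3 (c k : nat) : (3 <= c)%nat -> kap c k = (-1) ^ k / odd2 k.
Proof.
  intros H. unfold kap. rewrite delta_ge3 by exact H.
  rewrite Nat.mul_1_r. simpl. rewrite Rmult_1_r. reflexivity.
Qed.

Lemma lam3 (c k : nat) : (3 <= c)%nat -> lam c k = (-1) ^ k.
Proof. intros H. unfold lam. rewrite delta_ge3 by exact H. rewrite Nat.mul_1_r. simpl. ring. Qed.

Lemma kap0 (k : nat) : kap 0 k = (-1) ^ k * odd2 k.
Proof.
  unfold kap; cbn [delta]. replace (k * (1 + 2))%nat with (k * (2 * 1) + k)%nat by lia.
  rewrite pow_add, pow_m1_even. simpl. ring.
Qed.

Lemma pow_m1_sqr (k : nat) : (-1) ^ k * (-1) ^ k = 1.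
Proof. rewrite <- pow_add. replace (k + k)%nat with (2 * k)%nat by lia. apply pow_1_even. Qed.

(** The re-expansion of o_n^(2-c) b(n,m). For c >= 3 it is [bco_vsum_ones] with r = c - 3. For c = 1
    the truncated [c - 3] is 0, V^# is that of the empty index, and [lam 1 m] = o_m cancels its
    denominator, leaving [bco_odd_sum]. *)
Lemma bco_Vsharp (c m n : nat) : (1 <= c)%nat -> c <> 2%nat -> (1 <= m <= n)%nat ->
  lam c m * sumR1 n (fun k => if Nat.leb m k
    then bco n k * kap c k * Vsharp k m (repeat 1%nat (c - 3)) else 0) =
  odd2 n ^ 2 / odd2 n ^ c * bco n m.
Proof.
  intros Hc Hc2 H.
  pose proof (odd2_neq0 n ltac:(lia)) as Hn. pose proof (odd2_neq0 m ltac:(lia)) as Hm.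
  destruct (Nat.eq_dec c 1) as [->|Hc1].
  - rewrite lam1. rewrite <- sumR1_scal.
    replace (odd2 n ^ 2 / odd2 n ^ 1 * bco n m) with (odd2 n * bco n m)
      by (field; exact Hn).
    rewrite <- bco_odd_sum by exact H. apply sumR1_ext; intros k Hk.
    destruct (Nat.leb_spec m k); [|ring].
    rewrite Vsharp_vsum, kap1 by lia. simpl vsum. field; exact Hm.
  - rewrite lam3 by lia.
    transitivity ((-1) ^ m / odd2 m * sumR1 n (fun k => if Nat.leb m k
      then (-1) ^ k * bco n k * vsum k m (repeat 1%nat (c - 3)) else 0)).
    + rewrite <- !sumR1_scal. apply sumR1_ext; intros k Hk.
      destruct (Nat.leb_spec m k); [|ring].
      rewrite Vsharp_vsum, kap3 by lia. field.
      split; [exact Hm|apply odd2_neq0; lia].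
    + rewrite bco_vsum_ones by exact H.
      replace (odd2 n ^ c) with (odd2 n ^ 2 * odd2 n ^ S (c - 3))
        by (rewrite <- pow_add; f_equal; lia).
      transitivity ((-1) ^ m * (-1) ^ m * (/ odd2 n ^ S (c - 3) * bco n m)).
      * field. split; [now apply pow_nonzero|exact Hm].
      * rewrite pow_m1_sqr. field. split; [now apply pow_nonzero|exact Hn].
Qed.

(** Split 1/o_m^c as (o_m^2/o_m^c)/o_m^2: [bco_Vsharp] re-expands the first factor once the
    triangular sums are exchanged, and [bco_step] supplies the second. *)
Lemma bco_step_c (c : nat) (f tau : nat -> R) : (1 <= c)%nat -> c <> 2%nat ->
  (forall n, (1 <= n)%nat -> f n = sumR1 n (fun k => bco n k * tau k)) ->
  forall n, sumR1 n (fun m => / odd2 m ^ c * f m) =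
    sumR1 n (fun k => bco n k * (kap c k * sumR1 k (fun m =>
      Vsharp k m (repeat 1%nat (c - 3)) * lam c m * tau m) / odd2 k ^ 2)).
Proof.
  intros Hc Hc2 H n.
  rewrite <- (bco_step (fun n => odd2 n ^ 2 / odd2 n ^ c * f n)).
  - apply sumR1_ext; intros m Hm. field.
    pose proof (odd2_neq0 m ltac:(lia)). split; [now apply pow_nonzero|exact H0].
  - clear n; intros n Hn. rewrite H by exact Hn.
    transitivity (sumR1 n (fun k => sumR1 k (fun m =>
      bco n k * kap c k * Vsharp k m (repeat 1%nat (c - 3)) * (lam c m * tau m)))).
    2:{ apply sumR1_ext; intros k Hk. rewrite <- Rmult_assoc, <- sumR1_scal.
        apply sumR1_ext; intros; ring. }
    rewrite sumR1_triangle_swap, <- sumR1_scal. apply sumR1_ext; intros m Hm.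
    rewrite <- Rmult_assoc, <- bco_Vsharp by (try assumption; lia).
    transitivity (lam c m * tau m * sumR1 n (fun k => if Nat.leb m k
      then bco n k * kap c k * Vsharp k m (repeat 1%nat (c - 3)) else 0)); [ring|].
    rewrite <- sumR1_scal. apply sumR1_ext; intros k Hk.
    destruct (Nat.leb m k); ring.
Qed.

Lemma starsum_twos (s : list nat) (tau : nat -> R) (a : nat) :
  (forall n, (1 <= n)%nat -> starsum n s = sumR1 n (fun k => bco n k * tau k)) ->
  forall n, (1 <= n)%nat ->
    starsum n (repeat 2%nat a ++ s) = sumR1 n (fun k => bco n k * (tau k / odd2 k ^ (2 * a))).
Proof.
  intros H; induction a as [|a IH]; intros n Hn.
  - cbn [repeat app]. rewrite H by exact Hn. apply sumR1_ext; intros k Hk.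
    simpl; field.
  - cbn [repeat app starsum]. rewrite (bco_step _ _ IH).
    apply sumR1_ext; intros k Hk.
    replace (2 * S a)%nat with (2 * a + 2)%nat by lia. rewrite pow_add. field.
    pose proof (odd2_neq0 k ltac:(lia)). split; [assumption|now apply pow_nonzero].
Qed.

Definition phi (d : nat) (c : nat -> nat) (i k : nat) : R :=
  (-1) ^ (k * deltai d c i) * powerRZ (odd2 k) (Z.of_nat (deltai d c i) - 1).

Definition Vc (d : nat) (c : nat -> nat) (i k m : nat) : R :=
  Vsharp k m (repeat 1%nat (cext d c i - 3)).

(** The exponent [2 * a i + 2] is that of o_m in the term z_i^(2 a_i)/o_m^(2 a_i + 2) of the
    geometric series for 1/(o_m^2 - z_i^2). *)
Fixpoint TR (d : nat) (c a : nat -> nat) (i n k : nat) : R :=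
  match n with
  | O => 1
  | S n' => sumR1 k (fun m => phi d c i m * Vc d c i k m * / odd2 m ^ (2 * a i + 2)
                              * TR d c a (S i) n' m)
  end.

(** Induction from the right end of the index. There c_(d+1) = 0 gives [kap] = (-1)^k o_k, and
    [bco_leibniz] is the source of the minus sign. Afterwards the [kap] of an entry stays outside
    until the next entry to the left supplies a [lam], and [kap_lam] joins the two into [phi]. *)
Lemma starsum_bco (d : nat) (c a : nat -> nat) :
  (forall i, (1 <= i <= d)%nat -> (1 <= c i)%nat /\ c i <> 2%nat) ->
  forall n i, (i + n = d)%nat -> forall N, (1 <= N)%nat ->
  starsum N (repeat 2%nat (a i) ++ gtail c a (S i) n) =
  sumR1 N (fun k => bco N k * (- kap (cext d c (S i)) k * / odd2 k ^ (2 * a i + 2)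
                                 * TR d c a (S i) n k)).
Proof.
  intros hc n; induction n as [|n IH]; intros i Hi N HN.
  - cbn [gtail TR].
    rewrite (starsum_twos nil (fun k => - (-1) ^ k / odd2 k)); [|intros; symmetry; now apply bco_leibniz|exact HN].
    apply sumR1_ext; intros k Hk.
    replace (cext d c (S i)) with 0%nat.
    2:{ unfold cext. destruct (Nat.eqb_spec (S i) 0); [lia|].
        destruct (Nat.leb_spec (S i) d); [lia|reflexivity]. }
    rewrite kap0, pow_add. field. pose proof (odd2_neq0 k ltac:(lia)).
    auto using pow_nonzero.
  - cbn [gtail].
    destruct (hc (S i) ltac:(lia)) as [Hc Hc2].
    assert (Ec : cext d c (S i) = c (S i)).
    { unfold cext. destruct (Nat.eqb_spec (S i) 0); [lia|].
      destruct (Nat.leb_spec (S i) d); [reflexivity|lia]. }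
    rewrite (starsum_twos _ (fun k => - kap (c (S i)) k * TR d c a (S i) (S n) k / odd2 k ^ 2)).
    + apply sumR1_ext; intros k Hk. rewrite Ec, pow_add. field.
      pose proof (odd2_neq0 k ltac:(lia)). auto using pow_nonzero.
    + clear N HN; intros N HN. cbn [starsum].
      rewrite (bco_step_c _ _ _ Hc Hc2 (IH (S i) ltac:(lia))).
      apply sumR1_ext; intros k Hk. f_equal. unfold Rdiv. f_equal.
      cbn [TR].
      transitivity (kap (c (S i)) k * (-1 * sumR1 k (fun m => phi d c (S i) m * Vc d c (S i) k m
        * / odd2 m ^ (2 * a (S i) + 2) * TR d c a (S (S i)) n m))); [|ring].
      f_equal. rewrite <- sumR1_scal. apply sumR1_ext; intros m Hm.
      unfold phi, deltai. rewrite kap_lam by lia. unfold Vc. rewrite Ec. ring.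
    + exact HN.
Qed.

(** * Limits weighted by the coefficients b(n,k) *)

Lemma bco1_bounds (n : nat) : 0 <= bco1 n <= 2.
Proof.
  destruct n as [|n]; [simpl; lra|].
  (* The bound 2 alone is not inductive, since every factor exceeds 1; the induction carries b(n,1)
     <= 2 - 1/n. *)
  enough (H : 0 <= bco1 (S n) /\ bco1 (S n) * (INR n + 1) <= 2 * INR n + 1).
  { destruct H as [H1 H2]. split; [exact H1|]. pose proof (pos_INR n). nra. }
  induction n as [|n [IH1 IH2]]; [simpl; lra|].
  rewrite bco1_SS. pose proof (pos_INR n) as Hn.
  replace (odd2 (S (S n)) ^ 2 / (odd2 (S (S n)) ^ 2 - 1))
    with ((2 * INR n + 3) ^ 2 / (4 * (INR n + 1) * (INR n + 2)))
    by (unfold odd2; rewrite !S_INR; field; repeat split; nra).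
  assert (Hd : 0 < 4 * (INR n + 1) * (INR n + 2)) by nra.
  split.
  - apply Rmult_le_pos; [exact IH1|]. apply Rdiv_le_0_compat; [nra|exact Hd].
  - rewrite S_INR.
    apply Rmult_le_reg_r with (4 * (INR n + 1) ^ 2); [nra|].
    replace (bco1 (S n) * ((2 * INR n + 3) ^ 2 / (4 * (INR n + 1) * (INR n + 2)))
        * (INR n + 1 + 1) * (4 * (INR n + 1) ^ 2))
      with ((bco1 (S n) * (INR n + 1)) * (2 * INR n + 3) ^ 2)
      by (field; lra).
    apply Rle_trans with ((2 * INR n + 1) * (2 * INR n + 3) ^ 2).
    + apply Rmult_le_compat_r; [nra|exact IH2].
    + nra.
Qed.

Lemma bco_bounds (n k : nat) : 0 <= bco n k <= 2.
Proof.
  induction k as [|k IH]; [simpl; lra|].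
  destruct k as [|k]; [apply bco1_bounds|].
  destruct (Nat.le_gt_cases n (S k)) as [H|H].
  - rewrite bco_gt by lia; lra.
  - pose proof (bco_S n (S k) ltac:(lia)) as E.
    apply lt_INR in H. assert (0 < INR (S k)) by (apply lt_0_INR; lia). 
    replace (bco n (S (S k))) with ((INR n - INR (S k)) * bco n (S k) / (INR n + INR (S k)))
      by (rewrite <- E; field; lra).
    split.
    + apply Rdiv_le_0_compat; [|lra]. apply Rmult_le_pos; lra.
    + apply Rmult_le_reg_r with (INR n + INR (S k)); [lra|].
      unfold Rdiv; rewrite Rmult_assoc, Rinv_l, Rmult_1_r by lra. nra.
Qed.

(** The weights of Abel summation: for k >= 1 nonnegative, of total mass b(n,1) over k <= n, and
    tending to 0 as n grows with k fixed. Up to the total mass this is a regular Toeplitz matrix. *)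
Definition wco (n k : nat) : R := bco n k - bco n (S k).

Lemma wco_eq (n k : nat) : (1 <= k)%nat ->
  wco n k = 2 * INR k * bco n k / (INR n + INR k).
Proof.
  intros Hk. pose proof (bco_S n k Hk) as E. unfold wco.
  pose proof (pos_INR n). apply le_INR in Hk; simpl in Hk.
  replace (bco n (S k)) with ((INR n - INR k) * bco n k / (INR n + INR k))
    by (rewrite <- E; field; lra).
  field; lra.
Qed.

Lemma wco_ge0 (n k : nat) : (1 <= k)%nat -> 0 <= wco n k.
Proof.
  intros Hk; rewrite wco_eq by exact Hk.
  pose proof (bco_bounds n k). pose proof (pos_INR n).
  apply le_INR in Hk; simpl in Hk.
  apply Rdiv_le_0_compat; [|lra]. apply Rmult_le_pos; lra.
Qed.

Lemma wco_le (n k : nat) : (1 <= k)%nat -> (1 <= n)%nat -> wco n k <= 4 * INR k / INR n.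
Proof.
  intros Hk Hn; rewrite wco_eq by exact Hk.
  pose proof (bco_bounds n k).
  apply le_INR in Hk; simpl in Hk. apply le_INR in Hn; simpl in Hn.
  apply Rle_trans with (4 * INR k / (INR n + INR k)).
  - apply Rmult_le_compat_r; [left; apply Rinv_0_lt_compat; lra|nra].
  - apply Rmult_le_compat_l; [lra|]. apply Rinv_le_contravar; lra.
Qed.

Lemma wco_sum (n K : nat) : sumR1 K (wco n) = bco n 1 - bco n (S K).
Proof.
  induction K as [|K IH]; cbn [sumR1]; [ring|].
  rewrite IH; unfold wco; ring.
Qed.

Lemma sumR1_ge0 (n : nat) (f : nat -> R) :
  (forall k, (1 <= k <= n)%nat -> 0 <= f k) -> 0 <= sumR1 n f.
Proof.
  intros H. rewrite <- (sumR1_eq0 n (fun _ => 0)) by reflexivity.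
  apply sumR1_le; exact H.
Qed.

Lemma wco_toeplitz (e : nat -> R) :
  (forall k, 0 <= e k) ->
  (forall eps, 0 < eps -> exists K, forall k, (K <= k)%nat -> e k < eps) ->
  forall eps, 0 < eps -> exists N, forall n, (N <= n)%nat ->
    sumR1 n (fun k => wco n k * e k) < eps.
Proof.
  intros He0 He eps Heps.
  (* The total mass is at most 2, so the tail k > K contributes at most eps/2. The head has weights
     at most 4K/n, and N is chosen to make it smaller than eps/2. *)
  destruct (He (eps / 4) ltac:(lra)) as [K HK].
  set (M := sumR1 K e).
  assert (HM : 0 <= M) by (apply sumR1_ge0; intros; apply He0).
  destruct (INR_unbounded (8 * INR K * M / eps)) as [N HN].
  exists (S (N + K)). intros n Hn.
  assert (Hn' : INR N < INR n) by (apply lt_INR; lia).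
  assert (Hn0 : 1 <= INR n) by (apply (le_INR 1); lia).
  apply Rle_lt_trans with (sumR1 n (fun k => eps / 4 * wco n k
    + 4 * INR K / INR n * (if Nat.leb k K then e k else 0))).
  - apply sumR1_le; intros k Hk.
    pose proof (wco_ge0 n k ltac:(lia)) as W0.
    pose proof (wco_le n k ltac:(lia) ltac:(lia)) as W1.
    destruct (Nat.leb_spec k K) as [Hle|Hgt].
    + assert (wco n k <= 4 * INR K / INR n).
      { eapply Rle_trans; [exact W1|].
        apply Rmult_le_compat_r; [left; apply Rinv_0_lt_compat; lra|].
        apply le_INR in Hle; lra. }
      pose proof (He0 k).
      assert (wco n k * e k <= 4 * INR K / INR n * e k) by (apply Rmult_le_compat_r; assumption).
      assert (0 <= eps / 4 * wco n k) by (apply Rmult_le_pos; lra). lra.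
    + pose proof (HK k ltac:(lia)) as H.
      assert (wco n k * e k <= wco n k * (eps / 4)) by (apply Rmult_le_compat_l; lra). lra.
  - rewrite sumR1_plus, !sumR1_scal, wco_sum, <- sumR1_extend by lia.
    rewrite (bco_gt n (S n)) by lia. fold M.
    pose proof (bco_bounds n 1).
    assert (4 * INR K / INR n * M < eps / 2).
    { apply Rmult_lt_reg_r with (2 * INR n / eps).
      - apply Rdiv_lt_0_compat; lra.
      - replace (4 * INR K / INR n * M * (2 * INR n / eps)) with (8 * INR K * M / eps)
          by (field; lra).
        replace (eps / 2 * (2 * INR n / eps)) with (INR n) by (field; lra). lra. }
    nra.
Qed.

(** * Limits of complex sequences *)

Definition Clim (u : nat -> C) (L : C) : Prop :=
  forall eps, 0 < eps -> exists N, forall n, (N <= n)%nat -> Cmod (u n - L)%C < eps.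

Lemma Clim_filterlim (u : nat -> C) (L : C) :
  Clim u L -> filterlim u eventually (locally L).
Proof.
  intros H. apply (filterlim_locally (F := eventually) u L). intros eps.
  destruct (H eps (cond_pos eps)) as [N HN]. exists N. intros n Hn.
  apply C_NormedModule_mixin_compat1. exact (HN n Hn).
Qed.

Lemma Clim_ext_from (N0 : nat) (u v : nat -> C) (L : C) :
  (forall n, (N0 <= n)%nat -> u n = v n) -> Clim u L -> Clim v L.
Proof.
  intros E H eps Heps. destruct (H eps Heps) as [N HN].
  exists (N + N0)%nat. intros n Hn. rewrite <- E by lia. apply HN; lia.
Qed.

Lemma Clim_ext (u v : nat -> C) (L : C) :
  (forall n, u n = v n) -> Clim u L -> Clim v L.
Proof. intros E; apply (Clim_ext_from 0); intros; apply E. Qed.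

Lemma Clim_const (L : C) : Clim (fun _ => L) L.
Proof.
  intros eps Heps; exists 0%nat; intros n _.
  replace (L - L)%C with (RtoC 0) by ring. now rewrite Cmod_0.
Qed.

Lemma Clim_plus (u v : nat -> C) (L M : C) :
  Clim u L -> Clim v M -> Clim (fun n => u n + v n)%C (L + M)%C.
Proof.
  intros Hu Hv eps Heps.
  destruct (Hu (eps / 2) ltac:(lra)) as [N HN].
  destruct (Hv (eps / 2) ltac:(lra)) as [N' HN'].
  exists (N + N')%nat; intros n Hn.
  replace (u n + v n - (L + M))%C with ((u n - L) + (v n - M))%C by ring.
  eapply Rle_lt_trans; [apply Cmod_triangle|].
  specialize (HN n ltac:(lia)); specialize (HN' n ltac:(lia)); lra.
Qed.

Lemma Clim_mult (u v : nat -> C) (L M : C) :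
  Clim u L -> Clim v M -> Clim (fun n => u n * v n)%C (L * M)%C.
Proof.
  intros Hu Hv eps Heps.
  pose proof (Cmod_ge_0 L) as HL. pose proof (Cmod_ge_0 M) as HM.
  destruct (Hu (eps / (2 * (Cmod M + 1)))) as [N HN]; [apply Rdiv_lt_0_compat; lra|].
  destruct (Hv (eps / (2 * (Cmod L + 1)))) as [N' HN']; [apply Rdiv_lt_0_compat; lra|].
  destruct (Hv 1 ltac:(lra)) as [N2 HN2].
  exists (N + N' + N2)%nat; intros n Hn.
  replace (u n * v n - L * M)%C with ((u n - L) * v n + L * (v n - M))%C by ring.
  eapply Rle_lt_trans; [apply Cmod_triangle|]. rewrite !Cmod_mult.
  specialize (HN n ltac:(lia)); specialize (HN' n ltac:(lia)); specialize (HN2 n ltac:(lia)).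
  assert (Hvn : Cmod (v n) <= Cmod M + 1).
  { replace (v n) with ((v n - M) + M)%C by ring.
    eapply Rle_trans; [apply Cmod_triangle|]; lra. }
  pose proof (Cmod_ge_0 (u n - L)%C). pose proof (Cmod_ge_0 (v n - M)%C).
  assert (Cmod (u n - L)%C * Cmod (v n) <= Cmod (u n - L)%C * (Cmod M + 1))
    by (apply Rmult_le_compat_l; assumption).
  assert (Cmod (u n - L)%C * (Cmod M + 1) < eps / 2).
  { replace (eps / 2) with (eps / (2 * (Cmod M + 1)) * (Cmod M + 1)) by (field; lra).
    apply Rmult_lt_compat_r; lra. }
  assert (Cmod L * Cmod (v n - M)%C <= (Cmod L + 1) * Cmod (v n - M)%C)
    by (apply Rmult_le_compat_r; lra).
  assert ((Cmod L + 1) * Cmod (v n - M)%C < eps / 2).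
  { replace (eps / 2) with ((Cmod L + 1) * (eps / (2 * (Cmod L + 1)))) by (field; lra).
    apply Rmult_lt_compat_l; lra. }
  lra.
Qed.

Lemma Clim_sumC1 (K : nat) (u : nat -> nat -> C) (L : nat -> C) :
  (forall k, (1 <= k <= K)%nat -> Clim (fun n => u n k) (L k)) ->
  Clim (fun n => sumC1 K (u n)) (sumC1 K L).
Proof.
  induction K as [|K IH]; intros H; cbn [sumC1]; [apply Clim_const|].
  apply Clim_plus; [apply IH; intros; apply H; lia|apply H; lia].
Qed.

Lemma Clim_sumC0 (K : nat) (u : nat -> nat -> C) (L : nat -> C) :
  (forall k, Clim (fun n => u n k) (L k)) ->
  Clim (fun n => sumC0 K (u n)) (sumC0 K L).
Proof.
  intros H; induction K as [|K IH]; cbn [sumC0]; [apply H|].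
  apply Clim_plus; [apply IH|apply H].
Qed.

Lemma Clim_cauchy (u : nat -> C) :
  (forall eps, 0 < eps -> exists N, forall n m, (N <= n)%nat -> (N <= m)%nat ->
     Cmod (u n - u m)%C < eps) ->
  exists L, Clim u L.
Proof.
  intros H.
  assert (HR : forall f : C -> R,
    (forall x y, Rabs (f x - f y) <= Cmod (x - y)%C) ->
    exists l : R, is_lim_seq (fun n => f (u n)) l).
  { intros f Hf. apply ex_lim_seq_cauchy_corr. intros eps.
    destruct (H eps (cond_pos eps)) as [N HN]. exists N. intros n m Hn Hm.
    eapply Rle_lt_trans; [apply Hf|]. now apply HN. }
  destruct (HR fst) as [a Ha].
  { intros x y. change (fst x - fst y) with (fst (x - y)%C).
    eapply Rle_trans; [|apply Rmax_Cmod]. apply Rmax_l. }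
  destruct (HR snd) as [b Hb].
  { intros x y. change (snd x - snd y) with (snd (x - y)%C).
    eapply Rle_trans; [|apply Rmax_Cmod]. apply Rmax_r. }
  exists (a, b). intros eps Heps.
  apply is_lim_seq_spec in Ha; apply is_lim_seq_spec in Hb.
  destruct (Ha (mkposreal (eps / 2) ltac:(lra))) as [N1 HN1].
  destruct (Hb (mkposreal (eps / 2) ltac:(lra))) as [N2 HN2].
  exists (N1 + N2)%nat. intros n Hn.
  specialize (HN1 n ltac:(lia)); specialize (HN2 n ltac:(lia)); simpl in HN1, HN2.
  eapply Rle_lt_trans; [apply Cmod_2Rmax|].
  assert (Hs : sqrt 2 < 2).
  { rewrite <- (sqrt_square 2) at 2 by lra. apply sqrt_lt_1; lra. }
  assert (Hm : Rmax (Rabs (fst (u n - (a, b))%C)) (Rabs (snd (u n - (a, b))%C)) < eps / 2).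
  { apply Rmax_lub_lt; simpl; assumption. }
  pose proof (Rabs_pos (fst (u n - (a, b))%C)) as H0.
  pose proof (Rmax_l (Rabs (fst (u n - (a, b))%C)) (Rabs (snd (u n - (a, b))%C))).
  pose proof (sqrt_pos 2). nra.
Qed.

Lemma RtoC_sumR1 (n : nat) (f : nat -> R) :
  RtoC (sumR1 n f) = sumC1 n (fun k => RtoC (f k)).
Proof. induction n as [|n IH]; cbn [sumR1 sumC1]; [reflexivity|]. rewrite RtoC_plus, IH; reflexivity. Qed.

Lemma sumC1_ext (n : nat) (f g : nat -> C) :
  (forall k, (1 <= k <= n)%nat -> f k = g k) -> sumC1 n f = sumC1 n g.
Proof.
  induction n as [|n IH]; intros H; simpl; [reflexivity|].
  rewrite IH, (H (S n)) by (try lia; intros; apply H; lia); reflexivity.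
Qed.

Lemma sumC1_scal (n : nat) (a : C) (f : nat -> C) :
  sumC1 n (fun k => a * f k)%C = (a * sumC1 n f)%C.
Proof. induction n as [|n IH]; cbn [sumC1]; [ring|rewrite IH; ring]. Qed.

Lemma sumC1_plus (n : nat) (f g : nat -> C) :
  sumC1 n (fun k => f k + g k)%C = (sumC1 n f + sumC1 n g)%C.
Proof. induction n as [|n IH]; cbn [sumC1]; [ring|rewrite IH; ring]. Qed.

Lemma Cmod_sumC1 (n : nat) (f : nat -> C) (g : nat -> R) :
  (forall k, (1 <= k <= n)%nat -> Cmod (f k) <= g k) -> Cmod (sumC1 n f) <= sumR1 n g.
Proof.
  induction n as [|n IH]; intros H; cbn [sumC1 sumR1]; [rewrite Cmod_0; lra|].
  eapply Rle_trans; [apply Cmod_triangle|].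
  apply Rplus_le_compat; [apply IH; intros; apply H; lia|apply H; lia].
Qed.

Lemma bco_abel (n K : nat) (h : nat -> C) :
  sumC1 K (fun k => RtoC (bco n k) * h k)%C =
  (sumC1 K (fun k => RtoC (wco n k) * sumC1 k h) + RtoC (bco n (S K)) * sumC1 K h)%C.
Proof.
  induction K as [|K IH]; cbn [sumC1]; [ring|].
  rewrite IH. unfold wco. rewrite RtoC_minus. ring.
Qed.

(** The boundary term of Abel summation vanishes by b(n,n+1) = 0; what remains is a weighted sum of
    the errors of the partial sums. The total mass is left as b(n,1), since its limit is itself
    obtained by applying this lemma to Leibniz' series. *)
Lemma bco_toeplitz_diff (h : nat -> C) (H : C) :
  Clim (fun K => sumC1 K h) H ->
  Clim (fun n => sumC1 n (fun k => RtoC (bco n k) * h k) - RtoC (bco n 1) * H)%C (RtoC 0).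
Proof.
  intros HH eps Heps.
  destruct (wco_toeplitz (fun k => Cmod (sumC1 k h - H)%C)
    (fun k => Cmod_ge_0 _) HH eps Heps) as [N HN].
  exists N. intros n Hn. eapply Rle_lt_trans; [|exact (HN n Hn)].
  replace (sumC1 n (fun k => RtoC (bco n k) * h k) - RtoC (bco n 1) * H - RtoC 0)%C
    with (sumC1 n (fun k => RtoC (wco n k) * (sumC1 k h - H))%C).
  - apply Cmod_sumC1. intros k Hk. rewrite Cmod_mult, Cmod_R, Rabs_pos_eq; [lra|].
    apply wco_ge0; lia.
  - rewrite bco_abel. rewrite (bco_gt n (S n)) by lia.
    assert (E : RtoC (bco n 1) = sumC1 n (fun k => RtoC (wco n k))).
    { rewrite <- RtoC_sumR1, wco_sum, (bco_gt n (S n)) by lia. f_equal; ring. }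
    rewrite E.
    transitivity (sumC1 n (fun k => RtoC (wco n k) * sumC1 k h)%C
                  + (- H) * sumC1 n (fun k => RtoC (wco n k)))%C; [|ring].
    rewrite <- sumC1_scal, <- sumC1_plus. apply sumC1_ext; intros; ring.
Qed.

Lemma Clim_RtoC (u : nat -> R) (l : R) :
  is_lim_seq u l -> Clim (fun n => RtoC (u n)) (RtoC l).
Proof.
  intros H eps Heps. apply is_lim_seq_spec in H.
  destruct (H (mkposreal eps Heps)) as [N HN]. exists N. intros n Hn.
  rewrite <- RtoC_minus, Cmod_R. exact (HN n Hn).
Qed.

Definition leib (k : nat) : R := - (-1) ^ k / odd2 k.

Lemma leib_lim : is_lim_seq (fun K => sumR1 K leib) (PI / 4).
Proof.
  apply is_lim_seq_incr_1.
  rewrite <- Alt_PI_eq. unfold Alt_PI. destruct exist_PI as [l Hl].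
  replace (4 * l / 4) with l by field.
  apply is_lim_seq_ext with (fun N => sum_f_R0 (tg_alt PI_tg) N).
  2:{ apply is_lim_seq_Reals. exact Hl. }
  assert (E : forall n, tg_alt PI_tg n = leib (S n)).
  { intros n. unfold tg_alt, PI_tg, leib, odd2.
    replace (2 * INR (S n) - 1) with (INR (2 * n + 1))
      by (rewrite S_INR, plus_INR, mult_INR; simpl; ring).
    unfold Rdiv. simpl pow. ring. }
  intros n; induction n as [|n IH].
  - cbn [sum_f_R0 sumR1]. rewrite E; ring.
  - change (sumR1 (S (S n)) leib) with (sumR1 (S n) leib + leib (S (S n))).
    rewrite <- IH, <- E. reflexivity.
Qed.

(* Evaluating the finite identity at z = 0 gives 1 = sum_k b(n,k) leib(k), so
   Leibniz' series replaces Wallis' product here. *)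
Lemma bco1_lim : Clim (fun n => RtoC (bco n 1)) (RtoC (4 / PI)).
Proof.
  pose proof (bco_toeplitz_diff (fun k => RtoC (leib k)) (RtoC (PI / 4))) as H.
  assert (H1 : Clim (fun K => sumC1 K (fun k => RtoC (leib k))) (RtoC (PI / 4))).
  { apply (Clim_ext (fun K => RtoC (sumR1 K leib))); [intros; apply RtoC_sumR1|].
    apply Clim_RtoC, leib_lim. }
  specialize (H H1).
  pose proof PI_RGT_0 as Hpi.
  replace (RtoC (4 / PI)) with (RtoC (4 / PI) + RtoC (- (4 / PI)) * RtoC 0)%C by ring.
  refine (Clim_ext_from 1 _ _ _ _ (Clim_plus _ _ _ _ (Clim_const (RtoC (4 / PI)))
    (Clim_mult _ _ _ _ (Clim_const (RtoC (- (4 / PI)))) H))).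
  intros n Hn. cbn beta.
  rewrite (sumC1_ext n _ (fun k => RtoC (bco n k * leib k)))
    by (intros; rewrite RtoC_mult; reflexivity).
  rewrite <- RtoC_sumR1. unfold leib. rewrite bco_leibniz by exact Hn.
  rewrite <- RtoC_mult, <- RtoC_minus, <- RtoC_mult, <- RtoC_plus. f_equal. field; lra.
Qed.

Lemma bco_toeplitz (h : nat -> C) (H : C) :
  Clim (fun K => sumC1 K h) H ->
  Clim (fun n => sumC1 n (fun k => RtoC (bco n k) * h k)%C) (RtoC (4 / PI) * H)%C.
Proof.
  intros HH.
  replace (RtoC (4 / PI) * H)%C with (RtoC 0 + RtoC (4 / PI) * H)%C by ring.
  refine (Clim_ext _ _ _ _ (Clim_plus _ _ _ _ (bco_toeplitz_diff h H HH)
    (Clim_mult _ _ _ _ bco1_lim (Clim_const H)))).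
  intros n; cbn beta. ring.
Qed.

(** * Uniform convergence of the nested sums *)

(** Of logarithmic growth: each summation of 1/o_l inside a nested sum costs one more power of
    it. *)
Definition Hh (k : nat) : R := 1 + sumR1 k (fun l => / odd2 l).

Lemma inv_odd2_pos (k : nat) : (1 <= k)%nat -> 0 < / odd2 k.
Proof. intros H; apply Rinv_0_lt_compat; apply odd2_ge1 in H; lra. Qed.

Lemma Hh_S (k : nat) : Hh (S k) = Hh k + / odd2 (S k).
Proof. unfold Hh; cbn [sumR1]; ring. Qed.

Lemma Hh_le (m k : nat) : (m <= k)%nat -> Hh m <= Hh k.
Proof.
  intros H; induction H as [|k H IH]; [lra|].
  rewrite Hh_S. pose proof (inv_odd2_pos (S k) ltac:(lia)); lra.
Qed.

Lemma Hh_ge1 (k : nat) : 1 <= Hh k.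
Proof. replace 1 with (Hh 0) by (unfold Hh; simpl; ring). apply Hh_le; lia. Qed.

Lemma pow_diff_le (p : nat) (x y : R) : 0 <= y <= x ->
  x ^ S p - y ^ S p <= INR (S p) * x ^ p * (x - y).
Proof.
  intros H; induction p as [|p IH]; [simpl; lra|].
  rewrite S_INR. pose proof (pow_le x p ltac:(lra)) as Hx.
  assert (y ^ S p <= x ^ S p) by (apply pow_incr; lra).
  replace (x ^ S (S p) - y ^ S (S p))
    with (x * (x ^ S p - y ^ S p) + (x - y) * y ^ S p) by (simpl; ring).
  assert (x * (x ^ S p - y ^ S p) <= x * (INR (S p) * x ^ p * (x - y)))
    by (apply Rmult_le_compat_l; lra).
  assert ((x - y) * y ^ S p <= (x - y) * x ^ S p) by (apply Rmult_le_compat_l; lra).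
  replace ((INR (S p) + 1) * x ^ S p * (x - y))
    with (x * (INR (S p) * x ^ p * (x - y)) + (x - y) * x ^ S p) by (simpl; ring).
  lra.
Qed.

(** The difference is 2/(o_k (o_k + 2)), and o_k + 2 <= 3 o_k with equality at k = 1, whence the
    constant 3/2. *)
Lemma inv_odd2_sqr_le (k : nat) : (1 <= k)%nat ->
  / odd2 k ^ 2 <= 3 / 2 * (/ odd2 k - / odd2 (S k)).
Proof.
  intros H; apply odd2_ge1 in H. rewrite odd2_S.
  apply Rmult_le_reg_r with (2 * odd2 k ^ 2 * (odd2 k + 2)); [nra|].
  replace (/ odd2 k ^ 2 * (2 * odd2 k ^ 2 * (odd2 k + 2))) with (2 * odd2 k + 4)
    by (field; lra).
  replace (3 / 2 * (/ odd2 k - / (odd2 k + 2)) * (2 * odd2 k ^ 2 * (odd2 k + 2)))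
    with (6 * odd2 k) by (field; lra).
  lra.
Qed.

(* Summation by parts trades one power of the logarithmic factor [Hh] for a
   factor [1/odd2], which gives the induction on [p]. *)
Lemma Hh_series_bounded (p : nat) :
  exists B, forall K, sumR1 K (fun k => Hh k ^ p / odd2 k ^ 2) <= B.
Proof.
  assert (Main : forall p (B : R),
    (forall K, sumR1 K (fun k => (Hh k ^ p - Hh (pred k) ^ p) / odd2 k) <= B) ->
    forall K, sumR1 K (fun k => Hh k ^ p / odd2 k ^ 2) <= 3 / 2 * (B + 1)).
  { clear p; intros p B HB K.
    assert (E : forall K, sumR1 K (fun k => Hh k ^ p * (/ odd2 k - / odd2 (S k))) =
      - (Hh K ^ p / odd2 (S K)) + sumR1 K (fun k => (Hh k ^ p - Hh (pred k) ^ p) / odd2 k)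
      + 1).
    { clear K; intros K; induction K as [|K IH]; cbn [sumR1].
      - replace (Hh 0) with 1 by (unfold Hh; simpl; ring).
        rewrite pow1. unfold odd2; simpl. field.
      - rewrite IH. cbn [pred]. unfold Rdiv; ring. }
    apply Rle_trans with (3 / 2 * sumR1 K (fun k => Hh k ^ p * (/ odd2 k - / odd2 (S k)))).
    - rewrite <- sumR1_scal. apply sumR1_le; intros k Hk.
      pose proof (inv_odd2_sqr_le k ltac:(lia)) as H.
      pose proof (pow_le (Hh k) p ltac:(pose proof (Hh_ge1 k); lra)).
      unfold Rdiv at 1. nra.
    - rewrite E. specialize (HB K).
      assert (0 <= Hh K ^ p / odd2 (S K)).
      { apply Rmult_le_pos; [apply pow_le; pose proof (Hh_ge1 K); lra|].
        left; apply inv_odd2_pos; lia. }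
      lra. }
  induction p as [|p [B IH]].
  - exists (3 / 2 * (0 + 1)). apply Main. intros K. rewrite sumR1_eq0; [lra|].
    intros; simpl; unfold Rdiv; ring.
  - exists (3 / 2 * (INR (S p) * B + 1)). apply Main. intros K.
    apply Rle_trans with (INR (S p) * sumR1 K (fun k => Hh k ^ p / odd2 k ^ 2)).
    + rewrite <- sumR1_scal. apply sumR1_le; intros k Hk.
      destruct k as [|k]; [lia|]. cbn [pred].
      pose proof (inv_odd2_pos (S k) ltac:(lia)) as Ho. pose proof (Hh_ge1 k).
      replace (INR (S p) * (Hh (S k) ^ p / odd2 (S k) ^ 2))
        with (INR (S p) * Hh (S k) ^ p * (/ odd2 (S k)) * / odd2 (S k))
        by (field; apply odd2_neq0; lia).
      apply Rmult_le_compat_r; [lra|].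
      eapply Rle_trans; [exact (pow_diff_le p (Hh (S k)) (Hh k) ltac:(rewrite Hh_S; lra))|].
      rewrite (Hh_S k) at 2. right; ring.
    + apply Rmult_le_compat_l; [apply pos_INR|apply IH].
Qed.

Lemma vsum_ones_bounds (r m : nat) : (1 <= m)%nat -> forall k,
  0 <= vsum k m (repeat 1%nat r) <= 2 ^ S r * Hh k ^ r.
Proof.
  intros Hm; induction r as [|r IH]; intros k.
  - simpl. unfold tri; destruct (Nat.eqb k m); simpl; lra.
  - cbn [repeat vsum]. rewrite sumRfrom_indic by exact Hm.
    assert (T : forall l, 0 <= 2 ^ tri k l <= 2)
      by (intros l; unfold tri; destruct (Nat.eqb k l); simpl; lra).
    split.
    + apply sumR1_ge0; intros l Hl. destruct (Nat.leb m l); [|lra].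
      apply Rmult_le_pos; [|apply IH]. rewrite pow_1.
      apply Rmult_le_pos; [apply T|]. left; apply inv_odd2_pos; lia.
    + apply Rle_trans with (2 ^ S (S r) * Hh k ^ r * sumR1 k (fun l => / odd2 l)).
      * rewrite <- sumR1_scal. apply sumR1_le; intros l Hl.
        pose proof (inv_odd2_pos l ltac:(lia)) as Ho.
        assert (P : 0 <= 2 ^ S r * Hh k ^ r).
        { apply Rmult_le_pos; apply pow_le; [lra|pose proof (Hh_ge1 k); lra]. }
        destruct (Nat.leb m l).
        -- destruct (IH l) as [I1 I2]. specialize (T l).
           assert (vsum l m (repeat 1%nat r) <= 2 ^ S r * Hh k ^ r).
           { eapply Rle_trans; [exact I2|]. apply Rmult_le_compat_l; [apply pow_le; lra|].
             apply pow_incr. pose proof (Hh_ge1 l). pose proof (Hh_le l k ltac:(lia)). lra. }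
           rewrite pow_1. unfold Rdiv.
           replace (2 ^ S (S r) * Hh k ^ r * / odd2 l)
             with (2 * / odd2 l * (2 ^ S r * Hh k ^ r)) by (simpl; ring).
           apply Rmult_le_compat; [|exact I1| |assumption].
           ++ apply Rmult_le_pos; lra.
           ++ apply Rmult_le_compat_r; lra.
        -- replace (2 ^ S (S r) * Hh k ^ r * / odd2 l)
             with (2 * / odd2 l * (2 ^ S r * Hh k ^ r)) by (simpl; ring).
           apply Rmult_le_pos; [lra|exact P].
      * replace (2 ^ S (S r) * Hh k ^ S r) with (2 ^ S (S r) * Hh k ^ r * Hh k) by (simpl; ring).
        apply Rmult_le_compat_l.
        -- apply Rmult_le_pos; apply pow_le; [lra|pose proof (Hh_ge1 k); lra].
        -- unfold Hh; lra.
Qed.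

Lemma Vsharp_ones_bound (r m k : nat) : (1 <= m <= k)%nat ->
  Rabs (Vsharp k m (repeat 1%nat r)) <= odd2 k / odd2 m * (2 ^ S r * Hh k ^ r).
Proof.
  intros H. rewrite Vsharp_vsum by exact H.
  destruct (vsum_ones_bounds r m ltac:(lia) k) as [V1 V2].
  assert (0 <= odd2 k / odd2 m).
  { apply Rmult_le_pos; [pose proof (odd2_ge1 k ltac:(lia)); lra|].
    left; apply inv_odd2_pos; lia. }
  rewrite Rabs_pos_eq by (apply Rmult_le_pos; assumption).
  apply Rmult_le_compat_l; assumption.
Qed.

(* [gam i m] stands for the z_i-dependent part of the i-th factor: 1/((2m-1)^2 - z_i^2),
   one term of its geometric expansion, or a partial sum of the latter. *)
Fixpoint Tc (d : nat) (c : nat -> nat) (gam : nat -> nat -> C) (i n k : nat) : C :=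
  match n with
  | O => RtoC 1
  | S n' => sumC1 k (fun m => RtoC (phi d c i m * Vc d c i k m) * gam i m
                              * Tc d c gam (S i) n' m)%C
  end.

Definition tauc (d : nat) (c : nat -> nat) (gam : nat -> nat -> C) (k : nat) : C :=
  (RtoC (- kap (cext d c 1) k) * gam 0%nat k * Tc d c gam 1 d k)%C.

Lemma cext_in (d : nat) (c : nat -> nat) (i : nat) : (1 <= i <= d)%nat -> cext d c i = c i.
Proof.
  intros H. unfold cext. destruct (Nat.eqb_spec i 0); [lia|].
  destruct (Nat.leb_spec i d); [reflexivity|lia].
Qed.

Lemma cext_end (d : nat) (c : nat -> nat) : cext d c (S d) = 0%nat.
Proof.
  unfold cext. destruct (Nat.eqb_spec (S d) 0); [lia|].
  destruct (Nat.leb_spec (S d) d); [lia|reflexivity].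
Qed.

Lemma delta_le1 (c : nat) : (1 <= c)%nat -> (delta c <= 1)%nat.
Proof. intros H; destruct c as [|[|c]]; simpl; lia. Qed.

(** Here n counts the indices after the i-th. If some are left, both deltas are at most 1, so [phi]
    is at most o_m, and the factor o_m allows for the growth of the inner sum. At the last index
    c_(d+1) = 0 permits [phi] to reach o_m^2, but no inner sum remains. *)
Lemma phi_bound (d : nat) (c : nat -> nat) (i n m : nat) :
  (forall i, (1 <= i <= d)%nat -> (1 <= c i)%nat /\ c i <> 2%nat) ->
  (1 <= i)%nat -> (i + n = d)%nat -> (1 <= m)%nat ->
  Rabs (phi d c i m) * odd2 m ^ (Nat.min n 1) <= odd2 m ^ 2.
Proof.
  intros hc Hi Hn Hm. unfold phi.
  rewrite Rabs_mult, pow_1_abs, Rmult_1_l.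
  pose proof (odd2_ge1 m Hm) as Ho.
  rewrite Rabs_pos_eq by (apply powerRZ_le; lra).
  assert (Hd : (deltai d c i + Nat.min n 1 <= 3)%nat).
  { unfold deltai. rewrite (cext_in d c i) by lia.
    pose proof (delta_le1 (c i) (proj1 (hc i ltac:(lia)))).
    destruct n as [|n].
    - replace i with d in * by lia. rewrite cext_end. simpl; lia.
    - rewrite cext_in by lia.
      pose proof (delta_le1 (c (S i)) (proj1 (hc (S i) ltac:(lia)))). simpl; lia. }
  assert (Hq : forall e, (e <= 2)%nat -> odd2 m ^ e <= odd2 m ^ 2)
    by (intros e He; apply Rle_pow; assumption).
  destruct (deltai d c i) as [|e].
  - simpl powerRZ. rewrite Rmult_1_r.
    apply Rle_trans with (1 * odd2 m ^ Nat.min n 1).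
    + apply Rmult_le_compat_r; [apply pow_le; lra|].
      rewrite <- Rinv_1. apply Rinv_le_contravar; lra.
    + rewrite Rmult_1_l. apply Hq; lia.
  - replace (Z.of_nat (S e) - 1)%Z with (Z.of_nat e) by lia.
    rewrite <- pow_powerRZ, <- pow_add. apply Hq; lia.
Qed.

Definition gam_bounded (d : nat) (A : R) (gam : nat -> nat -> C) : Prop :=
  forall i m, (i <= d)%nat -> (1 <= m)%nat -> Cmod (gam i m) <= A / odd2 m ^ 2.

(** V^# gives o_k/o_m, [gam] gives 1/o_m^2, and [phi] times the growth of the inner sum is at most
    o_m^2. Up to powers of [Hh] this leaves o_k/o_m, whose sum over m costs one more power. [B] and
    [p] precede [gam], so the bound is uniform over all truncations of the geometric series. *)
Lemma Tc_bound (d : nat) (c : nat -> nat) (A : R) :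
  (forall i, (1 <= i <= d)%nat -> (1 <= c i)%nat /\ c i <> 2%nat) -> 0 <= A ->
  forall n i, (1 <= i)%nat -> (i + n = S d)%nat ->
  exists B p, 0 <= B /\ forall gam, gam_bounded d A gam -> forall k, (1 <= k)%nat ->
    Cmod (Tc d c gam i n k) <= B * odd2 k ^ (Nat.min n 1) * Hh k ^ p.
Proof.
  intros hc HA n; induction n as [|n IH]; intros i Hi Hn.
  - exists 1, 0%nat. split; [lra|]. intros gam _ k _. simpl. rewrite Cmod_1; lra.
  - destruct (IH (S i) ltac:(lia) ltac:(lia)) as [B [p [HB H]]].
    set (r := (cext d c i - 3)%nat).
    exists (2 ^ S r * A * B), (r + p + 1)%nat.
    assert (H2 : 0 <= 2 ^ S r) by (apply pow_le; lra).
    split; [apply Rmult_le_pos; [apply Rmult_le_pos|]; assumption|].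
    intros gam Hg k Hk. cbn [Tc].
    pose proof (odd2_ge1 k Hk) as Hok. pose proof (Hh_ge1 k) as HHk.
    assert (HP : 0 <= 2 ^ S r * A * B * odd2 k * Hh k ^ (r + p)).
    { apply Rmult_le_pos; [|apply pow_le; lra]. apply Rmult_le_pos; [|lra].
      apply Rmult_le_pos; [apply Rmult_le_pos|]; assumption. }
    apply Rle_trans with
      (sumR1 k (fun m => 2 ^ S r * A * B * odd2 k * Hh k ^ (r + p) * / odd2 m)).
    + apply Cmod_sumC1. intros m Hm.
      rewrite !Cmod_mult, Cmod_R, Rabs_mult.
      pose proof (odd2_ge1 m ltac:(lia)) as Hom. pose proof (Hh_ge1 m) as HHm.
      pose proof (phi_bound d c i n m hc Hi ltac:(lia) ltac:(lia)) as E1.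
      pose proof (Vsharp_ones_bound r m k ltac:(lia)) as E2. 
      pose proof (Hg i m ltac:(lia) ltac:(lia)) as E3.
      pose proof (H gam Hg m ltac:(lia)) as E4.
      assert (E4' : Cmod (Tc d c gam (S i) n m) <= B * odd2 m ^ Nat.min n 1 * Hh k ^ p).
      { eapply Rle_trans; [exact E4|]. apply Rmult_le_compat_l.
        - apply Rmult_le_pos; [exact HB|apply pow_le; lra].
        - apply pow_incr. pose proof (Hh_le m k ltac:(lia)). lra. }
      unfold Vc; fold r.
      pose proof (Rabs_pos (phi d c i m)) as P1.
      pose proof (Rabs_pos (Vsharp k m (repeat 1%nat r))) as P2.
      pose proof (Cmod_ge_0 (gam i m)) as P3.
      pose proof (Cmod_ge_0 (Tc d c gam (S i) n m)) as P4.
      apply Rle_trans with (Rabs (phi d c i m) * (odd2 k / odd2 m * (2 ^ S r * Hh k ^ r))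
        * (A / odd2 m ^ 2) * (B * odd2 m ^ Nat.min n 1 * Hh k ^ p)).
      * apply Rmult_le_compat; [|exact P4| |exact E4'].
        { apply Rmult_le_pos; [apply Rmult_le_pos|]; assumption. }
        apply Rmult_le_compat; [|exact P3| |exact E3].
        { apply Rmult_le_pos; assumption. }
        apply Rmult_le_compat_l; assumption.
      * replace (Rabs (phi d c i m) * (odd2 k / odd2 m * (2 ^ S r * Hh k ^ r))
          * (A / odd2 m ^ 2) * (B * odd2 m ^ Nat.min n 1 * Hh k ^ p))
          with (Rabs (phi d c i m) * odd2 m ^ Nat.min n 1 *
            (2 ^ S r * A * B * odd2 k * Hh k ^ (r + p) * / odd2 m ^ 3))
          by (rewrite pow_add; field; lra).
        replace (2 ^ S r * A * B * odd2 k * Hh k ^ (r + p) * / odd2 m)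
          with (odd2 m ^ 2 * (2 ^ S r * A * B * odd2 k * Hh k ^ (r + p) * / odd2 m ^ 3))
          by (field; lra).
        apply Rmult_le_compat_r; [|exact E1].
        apply Rmult_le_pos; [exact HP|left; apply Rinv_0_lt_compat, pow_lt; lra].
    + rewrite sumR1_scal.
      replace (2 ^ S r * A * B * odd2 k ^ Nat.min (S n) 1 * Hh k ^ (r + p + 1))
        with (2 ^ S r * A * B * odd2 k * Hh k ^ (r + p) * Hh k).
      2:{ rewrite (pow_add _ (r + p) 1). replace (Nat.min (S n) 1) with 1%nat by lia. ring. }
      apply Rmult_le_compat_l; [exact HP|unfold Hh; lra].
Qed.

Lemma sumC1_diff_bound (f : nat -> C) (u : nat -> R) :
  (forall k, (1 <= k)%nat -> Cmod (f k) <= u k) ->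
  forall n m, Cmod (sumC1 n f - sumC1 m f)%C <= Rabs (sumR1 n u - sumR1 m u).
Proof.
  intros H.
  assert (Main : forall m n, (m <= n)%nat ->
    Cmod (sumC1 n f - sumC1 m f)%C <= sumR1 n u - sumR1 m u).
  { intros m n Hmn; induction Hmn as [|n Hmn IH].
    - replace (sumC1 m f - sumC1 m f)%C with (RtoC 0) by ring. rewrite Cmod_0; lra.
    - cbn [sumC1 sumR1].
      replace (sumC1 n f + f (S n) - sumC1 m f)%C
        with ((sumC1 n f - sumC1 m f) + f (S n))%C by ring.
      eapply Rle_trans; [apply Cmod_triangle|].
      specialize (H (S n) ltac:(lia)); lra. }
  intros n m. destruct (Nat.le_ge_cases m n) as [Hmn|Hmn].
  - eapply Rle_trans; [now apply Main|apply Rle_abs].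
  - rewrite <- Cmod_opp.
    replace (- (sumC1 n f - sumC1 m f))%C with (sumC1 m f - sumC1 n f)%C by ring.
    rewrite Rabs_minus_sym. eapply Rle_trans; [now apply Main|apply Rle_abs].
Qed.

Lemma Hh_series_cauchy (p : nat) (eps : R) : 0 < eps ->
  exists K0, forall n m, (K0 <= n)%nat -> (K0 <= m)%nat ->
    Rabs (sumR1 n (fun k => Hh k ^ p / odd2 k ^ 2)
          - sumR1 m (fun k => Hh k ^ p / odd2 k ^ 2)) < eps.
Proof.
  intros Heps. destruct (Hh_series_bounded p) as [B HB].
  assert (E : ex_finite_lim_seq (fun K => sumR1 K (fun k => Hh k ^ p / odd2 k ^ 2))).
  { apply ex_finite_lim_seq_incr with B; [|exact HB].
    intros K. cbn [sumR1].
    assert (0 <= Hh (S K) ^ p / odd2 (S K) ^ 2); [|lra].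
    apply Rmult_le_pos; [apply pow_le; pose proof (Hh_ge1 (S K)); lra|].
    left; apply Rinv_0_lt_compat, pow_lt. pose proof (odd2_ge1 (S K) ltac:(lia)); lra. }
  apply ex_lim_seq_cauchy_corr in E.
  exact (E (mkposreal eps Heps)).
Qed.

Lemma leib_cauchy (eps : R) : 0 < eps ->
  exists K0, forall n m, (K0 <= n)%nat -> (K0 <= m)%nat ->
    Rabs (sumR1 n leib - sumR1 m leib) < eps.
Proof.
  intros Heps.
  assert (E : ex_finite_lim_seq (fun K => sumR1 K leib)) by (exists (PI / 4); apply leib_lim).
  apply ex_lim_seq_cauchy_corr in E. exact (E (mkposreal eps Heps)).
Qed.

(* For d >= 1 the series converges absolutely ([be] = 0); for d = 0 its
   conditionally convergent part is [al] times Leibniz' series. *)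
Lemma tauc_majorant (d : nat) (c : nat -> nat) (A : R) :
  (forall i, (1 <= i <= d)%nat -> (1 <= c i)%nat /\ c i <> 2%nat) ->
  ((1 <= d)%nat -> (3 <= c 1)%nat) -> 0 <= A ->
  exists B p, 0 <= B /\ forall gam al, gam_bounded d A gam -> Cmod al <= A ->
    (forall m, (1 <= m)%nat -> Cmod (gam 0%nat m - al * RtoC (/ odd2 m ^ 2))%C <= A / odd2 m ^ 4) ->
    exists be, Cmod be <= A /\ forall k, (1 <= k)%nat ->
      Cmod (tauc d c gam k - be * RtoC (leib k))%C <= B * (Hh k ^ p / odd2 k ^ 2).
Proof.
  intros hc hc1 HA. destruct d as [|d].
  - exists A, 0%nat. split; [exact HA|]. intros gam al Hg Hal H.
    exists al. split; [exact Hal|]. intros k Hk.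
    pose proof (odd2_ge1 k Hk) as Ho.
    unfold tauc. rewrite cext_end, kap0. cbn [Tc].
    replace (RtoC (- ((-1) ^ k * odd2 k)) * gam 0%nat k * RtoC 1 - al * RtoC (leib k))%C
      with (RtoC (- ((-1) ^ k * odd2 k)) * (gam 0%nat k - al * RtoC (/ odd2 k ^ 2)))%C.
    + rewrite Cmod_mult, Cmod_R, Rabs_Ropp, Rabs_mult, pow_1_abs, Rmult_1_l.
      rewrite Rabs_pos_eq by lra. simpl (Hh k ^ 0).
      apply Rle_trans with (odd2 k * (A / odd2 k ^ 4));
        [apply Rmult_le_compat_l; [lra|now apply H]|].
      apply Rle_trans with (A * / odd2 k ^ 3); [right; field; lra|].
      unfold Rdiv; rewrite Rmult_1_l. apply Rmult_le_compat_l; [exact HA|].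
      apply Rinv_le_contravar; [apply pow_lt; lra|apply Rle_pow; [lra|lia]].
    + replace (RtoC (leib k)) with (RtoC (- ((-1) ^ k * odd2 k)) * RtoC (/ odd2 k ^ 2))%C.
      * ring.
      * rewrite <- RtoC_mult. f_equal. unfold leib. field; lra.
  - destruct (Tc_bound (S d) c A hc HA (S d) 1 ltac:(lia) ltac:(lia)) as [B [p [HB H]]].
    exists (A * B), p. split; [now apply Rmult_le_pos|]. intros gam al Hg _ _.
    exists (RtoC 0). split; [rewrite Cmod_0; exact HA|]. intros k Hk.
    pose proof (odd2_ge1 k Hk) as Ho.
    replace (tauc (S d) c gam k - RtoC 0 * RtoC (leib k))%C with (tauc (S d) c gam k) by ring.
    unfold tauc. rewrite cext_in by lia. rewrite kap3 by (apply hc1; lia).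
    rewrite !Cmod_mult, Cmod_R, Rabs_Ropp. unfold Rdiv at 1.
    rewrite Rabs_mult, pow_1_abs, Rmult_1_l, Rabs_pos_eq by (left; now apply inv_odd2_pos).
    apply Rle_trans with (/ odd2 k * (A / odd2 k ^ 2)
      * (B * odd2 k ^ Nat.min (S d) 1 * Hh k ^ p)).
    + pose proof (inv_odd2_pos k Hk). apply Rmult_le_compat.
      * apply Rmult_le_pos; [lra|apply Cmod_ge_0].
      * apply Cmod_ge_0.
      * apply Rmult_le_compat_l; [lra|]. apply Hg; lia.
      * now apply H.
    + replace (Nat.min (S d) 1) with 1%nat by lia. right; field; lra.
Qed.

(** [K0] precedes [gam] and [al]: this is the uniformity that the exchange of limits requires. It
    extends to the conditionally convergent part because the coefficient of Leibniz' series is at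
    most A. *)
Lemma tauc_cauchy (d : nat) (c : nat -> nat) (A eps : R) :
  (forall i, (1 <= i <= d)%nat -> (1 <= c i)%nat /\ c i <> 2%nat) ->
  ((1 <= d)%nat -> (3 <= c 1)%nat) -> 0 <= A -> 0 < eps ->
  exists K0, forall gam al, gam_bounded d A gam -> Cmod al <= A ->
    (forall m, (1 <= m)%nat -> Cmod (gam 0%nat m - al * RtoC (/ odd2 m ^ 2))%C <= A / odd2 m ^ 4) ->
    forall n m, (K0 <= n)%nat -> (K0 <= m)%nat ->
      Cmod (sumC1 n (tauc d c gam) - sumC1 m (tauc d c gam))%C < eps.
Proof.
  intros hc hc1 HA Heps.
  destruct (tauc_majorant d c A hc hc1 HA) as [B [p [HB H]]].
  destruct (Hh_series_cauchy p (eps / (2 * (B + 1)))) as [K1 HK1];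
    [apply Rdiv_lt_0_compat; lra|].
  destruct (leib_cauchy (eps / (2 * (A + 1)))) as [K2 HK2];
    [apply Rdiv_lt_0_compat; lra|].
  exists (K1 + K2)%nat. intros gam al Hg Hal H0 n m Hn Hm.
  destruct (H gam al Hg Hal H0) as [be [Hbe Hm']].
  specialize (HK1 n m ltac:(lia) ltac:(lia)). specialize (HK2 n m ltac:(lia) ltac:(lia)).
  pose proof (sumC1_diff_bound _ _ Hm' n m) as D.
  rewrite !sumR1_scal, <- Rmult_minus_distr_l, Rabs_mult, (Rabs_pos_eq B HB) in D.
  assert (E : forall j, sumC1 j (tauc d c gam) =
    (sumC1 j (fun k => tauc d c gam k - be * RtoC (leib k)) + be * RtoC (sumR1 j leib))%C).
  { intros j. rewrite RtoC_sumR1, <- sumC1_scal, <- sumC1_plus. apply sumC1_ext; intros; ring. }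
  rewrite (E n), (E m).
  set (f := fun k => (tauc d c gam k - be * RtoC (leib k))%C) in *.
  replace (sumC1 n f + be * RtoC (sumR1 n leib) - (sumC1 m f + be * RtoC (sumR1 m leib)))%C
    with ((sumC1 n f - sumC1 m f) + be * RtoC (sumR1 n leib - sumR1 m leib))%C
    by (rewrite RtoC_minus; ring).
  eapply Rle_lt_trans; [apply Cmod_triangle|]. rewrite Cmod_mult, Cmod_R.
  set (x := Rabs (sumR1 n (fun k => Hh k ^ p / odd2 k ^ 2)
          - sumR1 m (fun k => Hh k ^ p / odd2 k ^ 2))) in *.
  set (y := Rabs (sumR1 n leib - sumR1 m leib)) in *.
  assert (0 <= x) by apply Rabs_pos. assert (0 <= y) by apply Rabs_pos.
  assert (B * x <= (B + 1) * x) by nra.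
  assert ((B + 1) * x < eps / 2).
  { replace (eps / 2) with ((B + 1) * (eps / (2 * (B + 1)))) by (field; lra).
    apply Rmult_lt_compat_l; lra. }
  assert (Cmod be * y <= (A + 1) * y) by (apply Rmult_le_compat_r; lra).
  assert ((A + 1) * y < eps / 2).
  { replace (eps / 2) with ((A + 1) * (eps / (2 * (A + 1)))) by (field; lra).
    apply Rmult_lt_compat_l; lra. }
  lra.
Qed.

(** * Passage to the limit *)

Lemma Clim_unique (u : nat -> C) (L M : C) : Clim u L -> Clim u M -> L = M.
Proof.
  intros HL HM.
  destruct (Req_dec (Cmod (L - M)%C) 0) as [E|E].
  - apply Cmod_eq_0 in E. replace L with ((L - M) + M)%C by ring. rewrite E; ring.
  - pose proof (Cmod_ge_0 (L - M)%C).
    destruct (HL (Cmod (L - M)%C / 2) ltac:(lra)) as [N1 H1].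
    destruct (HM (Cmod (L - M)%C / 2) ltac:(lra)) as [N2 H2].
    specialize (H1 (N1 + N2)%nat ltac:(lia)); specialize (H2 (N1 + N2)%nat ltac:(lia)).
    pose proof (Cmod_triangle (- (u (N1 + N2)%nat - L))%C (u (N1 + N2)%nat - M)%C) as T.
    rewrite Cmod_opp in T.
    replace (- (u (N1 + N2)%nat - L) + (u (N1 + N2)%nat - M))%C with (L - M)%C in T by ring.
    lra.
Qed.

(** The Moore-Osgood theorem. The uniform Cauchy condition passes to y, so the common limit is
    produced here rather than assumed. *)
Lemma Clim_uniform_interchange (x : nat -> nat -> C) (X y : nat -> C) :
  (forall eps, 0 < eps -> exists K0, forall N n m, (K0 <= n)%nat -> (K0 <= m)%nat ->
     Cmod (x N n - x N m)%C < eps) ->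
  (forall N, Clim (x N) (X N)) ->
  (forall K, Clim (fun N => x N K) (y K)) ->
  exists L, Clim y L /\ Clim X L.
Proof.
  intros HU HX Hy.
  assert (T3 : forall a b c d : C, Cmod (a - d)%C <=
    Cmod (b - a)%C + Cmod (b - c)%C + Cmod (c - d)%C).
  { intros a b c d.
    replace (a - d)%C with ((- (b - a) + (b - c)) + (c - d))%C by ring.
    eapply Rle_trans; [apply Cmod_triangle|]. apply Rplus_le_compat_r.
    eapply Rle_trans; [apply Cmod_triangle|]. rewrite Cmod_opp; lra. }
  destruct (Clim_cauchy y) as [L HL].
  - intros eps Heps. destruct (HU (eps / 3) ltac:(lra)) as [K0 HK].
    exists K0. intros n m Hn Hm.
    destruct (Hy n (eps / 3) ltac:(lra)) as [N1 H1].
    destruct (Hy m (eps / 3) ltac:(lra)) as [N2 H2].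
    specialize (H1 (N1 + N2)%nat ltac:(lia)); specialize (H2 (N1 + N2)%nat ltac:(lia)).
    specialize (HK (N1 + N2)%nat n m Hn Hm).
    pose proof (T3 (y n) (x (N1 + N2)%nat n) (x (N1 + N2)%nat m) (y m)). lra.
  - exists L. split; [exact HL|]. intros eps Heps.
    destruct (HU (eps / 6) ltac:(lra)) as [K0 HK].
    destruct (HL (eps / 6) ltac:(lra)) as [K1 HK1].
    set (K := (K0 + K1)%nat).
    destruct (Hy K (eps / 6) ltac:(lra)) as [N0 HN]. exists N0. intros N HN0.
    specialize (HN N HN0). specialize (HK1 K ltac:(lia)).
    destruct (HX N (eps / 6) ltac:(lra)) as [K2 HK2].
    specialize (HK2 (K + K2)%nat ltac:(lia)).
    specialize (HK N (K + K2)%nat K ltac:(lia) ltac:(lia)).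
    pose proof (T3 (X N) (x N (K + K2)%nat) (x N K) L) as T.
    assert (Cmod (x N K - L)%C <= Cmod (x N K - y K)%C + Cmod (y K - L)%C).
    { replace (x N K - L)%C with ((x N K - y K) + (y K - L))%C by ring. apply Cmod_triangle. }
    lra.
Qed.

(** * Rearranging box sums and chain sums *)

Lemma sumC0_ext (N : nat) (f g : nat -> C) : (forall a, f a = g a) -> sumC0 N f = sumC0 N g.
Proof. intros H; induction N as [|N IH]; cbn [sumC0]; rewrite ?IH, H; reflexivity. Qed.

Lemma sumC0_scal (N : nat) (b : C) (f : nat -> C) :
  sumC0 N (fun a => b * f a)%C = (b * sumC0 N f)%C.
Proof. induction N as [|N IH]; cbn [sumC0]; [reflexivity|rewrite IH; ring]. Qed.

Lemma sumC0_sumC1 (N K : nat) (f : nat -> nat -> C) :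
  sumC0 N (fun a => sumC1 K (f a)) = sumC1 K (fun k => sumC0 N (fun a => f a k)).
Proof.
  induction N as [|N IH]; cbn [sumC0]; [reflexivity|].
  rewrite IH, <- sumC1_plus; reflexivity.
Qed.

Lemma boxsum_ext (N n : nat) (F G : list nat -> C) :
  (forall l, F l = G l) -> boxsum N n F = boxsum N n G.
Proof.
  revert F G; induction n as [|n IH]; intros F G H; cbn [boxsum]; [apply H|].
  apply sumC0_ext; intros a. apply IH; intros; apply H.
Qed.

Lemma boxsum_scal (N n : nat) (b : C) (F : list nat -> C) :
  boxsum N n (fun l => b * F l)%C = (b * boxsum N n F)%C.
Proof.
  revert F; induction n as [|n IH]; intros F; cbn [boxsum]; [reflexivity|].
  rewrite <- sumC0_scal. apply sumC0_ext; intros a. apply IH.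
Qed.

Lemma boxsum_sumC1 (N n K : nat) (F : nat -> list nat -> C) :
  boxsum N n (fun l => sumC1 K (fun k => F k l)) = sumC1 K (fun k => boxsum N n (F k)).
Proof.
  revert F; induction n as [|n IH]; intros F; cbn [boxsum]; [reflexivity|].
  rewrite <- sumC0_sumC1. apply sumC0_ext; intros a.
  apply (IH (fun k l => F k (a :: l))).
Qed.

Lemma Clim_boxsum (N n : nat) (F : nat -> list nat -> C) (L : list nat -> C) :
  (forall l, Clim (fun j => F j l) (L l)) ->
  Clim (fun j => boxsum N n (F j)) (boxsum N n L).
Proof.
  revert F L; induction n as [|n IH]; intros F L H; cbn [boxsum]; [apply H|].
  apply Clim_sumC0; intros a. apply IH; intros; apply H.
Qed.

Lemma chainsum_ext (n M : nat) (F G : list nat -> C) :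
  (forall l, F l = G l) -> chainsum M n F = chainsum M n G.
Proof.
  revert M F G; induction n as [|n IH]; intros M F G H; cbn [chainsum]; [apply H|].
  apply sumC1_ext; intros k _. apply IH; intros; apply H.
Qed.

Lemma chainsum_scal (n M : nat) (b : C) (F : list nat -> C) :
  chainsum M n (fun l => b * F l)%C = (b * chainsum M n F)%C.
Proof.
  revert M F; induction n as [|n IH]; intros M F; cbn [chainsum]; [reflexivity|].
  rewrite <- sumC1_scal. apply sumC1_ext; intros k _. apply IH.
Qed.

Fixpoint prodfrom (w : nat -> C) (i n : nat) : C :=
  match n with O => RtoC 1 | S n' => (w i * prodfrom w (S i) n')%C end.

Lemma prodfrom_ext (w w' : nat -> C) (n i : nat) :
  (forall j, (i <= j)%nat -> w j = w' j) -> prodfrom w i n = prodfrom w' i n.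
Proof.
  revert i; induction n as [|n IH]; intros i H; cbn [prodfrom]; [reflexivity|].
  rewrite H, IH by (try lia; intros; apply H; lia); reflexivity.
Qed.

Lemma prodfrom_last (w : nat -> C) (n i : nat) :
  prodfrom w i (S n) = (prodfrom w i n * w (i + n)%nat)%C.
Proof.
  revert i; induction n as [|n IH]; intros i.
  - cbn [prodfrom]. rewrite Nat.add_0_r. ring.
  - change (prodfrom w i (S (S n))) with (w i * prodfrom w (S i) (S n))%C.
    rewrite IH. cbn [prodfrom]. replace (S i + n)%nat with (i + S n)%nat by lia. ring.
Qed.

Lemma prodC0_prodfrom (n : nat) (w : nat -> C) : prodC0 n w = prodfrom w 0 (S n).
Proof.
  induction n as [|n IH]; cbn [prodC0]; [cbn [prodfrom]; ring|].
  rewrite prodfrom_last, IH. reflexivity.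
Qed.

(** The previous index [p] and the upper bound [M] agree except at the outermost level, where k_(-1)
    = 0 while k_0 runs up to N. *)
Fixpoint Ch (f : nat -> nat -> nat -> C) (i n p M : nat) : C :=
  match n with
  | O => RtoC 1
  | S n' => sumC1 M (fun k => f i p k * Ch f (S i) n' k k)%C
  end.

Lemma chainsum_prodfrom (f : nat -> nat -> nat -> C) (n i p M : nat) :
  chainsum M n (fun l => prodfrom (fun j =>
    f j (match (j - i)%nat with O => p | S i' => nth i' l 0%nat end)
        (nth (j - i) l 0%nat)) i n) = Ch f i n p M.
Proof.
  revert i p M; induction n as [|n IH]; intros i p M; cbn [chainsum Ch]; [reflexivity|].
  apply sumC1_ext; intros k _.
  rewrite <- IH, <- chainsum_scal. apply chainsum_ext; intros l.
  cbn [prodfrom]. rewrite Nat.sub_diag. cbn [nth]. f_equal.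
  apply prodfrom_ext; intros j Hj.
  replace (j - i)%nat with (S (j - S i)) by lia. cbn [nth].
  destruct (j - S i)%nat; reflexivity.
Qed.

Lemma Tc_ext (d : nat) (c : nat -> nat) (g g' : nat -> nat -> C) (n i k : nat) :
  (forall j m, (i <= j)%nat -> g j m = g' j m) -> Tc d c g i n k = Tc d c g' i n k.
Proof.
  revert i k; induction n as [|n IH]; intros i k H; cbn [Tc]; [reflexivity|].
  apply sumC1_ext; intros m _.
  rewrite H, IH by (try lia; intros; apply H; lia); reflexivity.
Qed.

(** Level j of the nested sum involves only a_j, so the sum over the box distributes over the
    levels, leaving one truncated series at each. *)
Lemma Tc_boxsum (d : nat) (c : nat -> nat) (g : nat -> nat -> nat -> C) (N n i k : nat) :
  boxsum N n (fun l => Tc d c (fun j m => g j (nth (j - i) l 0%nat) m) i n k) =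
  Tc d c (fun j m => sumC0 N (fun a => g j a m)) i n k.
Proof.
  revert i k; induction n as [|n IH]; intros i k; cbn [boxsum Tc]; [reflexivity|].
  transitivity (sumC0 N (fun a => sumC1 k (fun m =>
    RtoC (phi d c i m * Vc d c i k m) *
    Tc d c (fun j m => sumC0 N (fun a => g j a m)) (S i) n m * g i a m)))%C.
  - apply sumC0_ext; intros a.
    rewrite (boxsum_sumC1 N n k (fun m l => RtoC (phi d c i m * Vc d c i k m)
      * g i (nth (i - i) (a :: l) 0%nat) m
      * Tc d c (fun j m0 => g j (nth (j - i) (a :: l) 0%nat) m0) (S i) n m)%C).
    apply sumC1_ext; intros m _. rewrite <- IH, Nat.sub_diag. cbn [nth].
    transitivity (RtoC (phi d c i m * Vc d c i k m) * g i a m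
      * boxsum N n (fun l =>
          Tc d c (fun j m0 => g j (nth (j - S i) l 0%nat) m0) (S i) n m))%C; [|ring].
    rewrite <- boxsum_scal. apply boxsum_ext; intros l. f_equal.
    apply Tc_ext; intros j m0 Hj. replace (j - i)%nat with (S (j - S i)) by lia. reflexivity.
  - rewrite sumC0_sumC1. apply sumC1_ext; intros m _. rewrite sumC0_scal. ring.
Qed.

Lemma tauc_boxsum (d : nat) (c : nat -> nat) (g : nat -> nat -> nat -> C) (N k : nat) :
  boxsum N (S d) (fun l => tauc d c (fun j m => g j (nth j l 0%nat) m) k) =
  tauc d c (fun j m => sumC0 N (fun a => g j a m)) k.
Proof.
  unfold tauc. rewrite <- Tc_boxsum. cbn [boxsum nth].
  transitivity (sumC0 N (fun a => RtoC (- kap (cext d c 1) k)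
    * boxsum N d (fun l => Tc d c (fun j m => g j (nth (j - 1) l 0%nat) m) 1 d k)
    * g 0%nat a k))%C.
  - apply sumC0_ext; intros a.
    transitivity (RtoC (- kap (cext d c 1) k) * g 0%nat a k
      * boxsum N d (fun l => Tc d c (fun j m => g j (nth (j - 1) l 0%nat) m) 1 d k))%C; [|ring].
    rewrite <- boxsum_scal. apply boxsum_ext; intros l. f_equal.
    apply Tc_ext; intros j m Hj. destruct j as [|j]; [lia|].
    cbn [nth]. rewrite Nat.sub_succ, Nat.sub_0_r. reflexivity.
  - rewrite sumC0_scal. ring.
Qed.

Lemma Tc_weights (d : nat) (c a : nat -> nat) (w : nat -> C) (n i k : nat) :
  Tc d c (fun j m => RtoC (/ odd2 m ^ (2 * a j + 2)) * w j)%C i n k =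
  (RtoC (TR d c a i n k) * prodfrom w i n)%C.
Proof.
  revert i k; induction n as [|n IH]; intros i k; cbn [Tc TR prodfrom]; [ring|].
  rewrite RtoC_sumR1.
  transitivity (w i * prodfrom w (S i) n * sumC1 k (fun m => RtoC (phi d c i m * Vc d c i k m
    * / odd2 m ^ (2 * a i + 2) * TR d c a (S i) n m)))%C; [|ring].
  rewrite <- sumC1_scal. apply sumC1_ext; intros m _. rewrite IH, !RtoC_mult. ring.
Qed.

(** The weights are arbitrary because two choices matter: [w = 1] for the convergence behind
    [tstar], and w_j = z_j^(2 a_j) for the box sums. *)
Lemma starsum_tauc (d : nat) (c a : nat -> nat) (w : nat -> C) (n : nat) :
  (forall i, (1 <= i <= d)%nat -> (1 <= c i)%nat /\ c i <> 2%nat) -> (1 <= n)%nat ->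
  (RtoC (starsum n (Gidx d c a)) * prodC0 d w)%C =
  sumC1 n (fun k => RtoC (bco n k) *
    tauc d c (fun j m => RtoC (/ odd2 m ^ (2 * a j + 2)) * w j) k)%C.
Proof.
  intros hc Hn. unfold Gidx.
  rewrite (starsum_bco d c a hc d 0 eq_refl n Hn), prodC0_prodfrom, RtoC_sumR1.
  rewrite Cmult_comm, <- sumC1_scal. apply sumC1_ext; intros k _.
  unfold tauc. rewrite Tc_weights, !RtoC_mult. cbn [prodfrom]. ring.
Qed.

(** * Convergence of t-star values and the geometric series in the z_i *)

Lemma Cmod_Cpow (x : C) (n : nat) : Cmod (Defs.Cpow x n) = Cmod x ^ n.
Proof.
  induction n as [|n IH]; cbn [Defs.Cpow pow]; [apply Cmod_1|].
  rewrite Cmod_mult, IH; reflexivity.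
Qed.

Lemma Cpow_add (x : C) (n m : nat) :
  Defs.Cpow x (n + m) = (Defs.Cpow x n * Defs.Cpow x m)%C.
Proof. induction n as [|n IH]; cbn [Defs.Cpow Nat.add]; [ring|rewrite IH; ring]. Qed.

Lemma inv_odd2_pow_le (m e f : nat) : (1 <= m)%nat -> (e <= f)%nat ->
  / odd2 m ^ f <= / odd2 m ^ e.
Proof.
  intros Hm Hef. pose proof (odd2_ge1 m Hm).
  apply Rinv_le_contravar; [apply pow_lt; lra|now apply Rle_pow].
Qed.

Lemma inv_odd2_pow_pos (m e : nat) : (1 <= m)%nat -> 0 < / odd2 m ^ e.
Proof.
  intros Hm. pose proof (odd2_ge1 m Hm). apply Rinv_0_lt_compat, pow_lt; lra.
Qed.

Lemma tauc_lim (d : nat) (c : nat -> nat) (A : R) (gam : nat -> nat -> C) (al : C) :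
  (forall i, (1 <= i <= d)%nat -> (1 <= c i)%nat /\ c i <> 2%nat) ->
  ((1 <= d)%nat -> (3 <= c 1)%nat) -> 0 <= A ->
  gam_bounded d A gam -> Cmod al <= A ->
  (forall m, (1 <= m)%nat -> Cmod (gam 0%nat m - al * RtoC (/ odd2 m ^ 2))%C <= A / odd2 m ^ 4) ->
  exists L, Clim (fun K => sumC1 K (tauc d c gam)) L.
Proof.
  intros hc hc1 HA Hg Hal H. apply Clim_cauchy. intros eps Heps.
  destruct (tauc_cauchy d c A eps hc hc1 HA Heps) as [K0 HK].
  exists K0. intros n m. exact (HK gam al Hg Hal H n m).
Qed.

(** [tstar] takes [real] of a [Lim_seq], so it is meaningful only once convergence is known. The
    finite identity provides it, with 4/pi times the sum of tau(k) as the limit. *)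
Lemma tstar_lim (d : nat) (c a : nat -> nat) :
  (forall i, (1 <= i <= d)%nat -> (1 <= c i)%nat /\ c i <> 2%nat) ->
  ((1 <= d)%nat -> (3 <= c 1)%nat) ->
  Clim (fun n => RtoC (starsum n (Gidx d c a))) (RtoC (tstar (Gidx d c a))).
Proof.
  intros hc hc1.
  set (gam := fun j m => (RtoC (/ odd2 m ^ (2 * a j + 2)) * RtoC 1)%C).
  assert (Eg : forall j m, (1 <= m)%nat -> Cmod (gam j m) = / odd2 m ^ (2 * a j + 2)).
  { intros j m Hm. unfold gam. rewrite Cmod_mult, Cmod_1, Cmod_R, Rabs_pos_eq; [ring|].
    left; now apply inv_odd2_pow_pos. }
  (* [al] is the coefficient of 1/o_m^2 in [gam 0]: for a_0 = 0 the two agree exactly, otherwise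
     [gam 0] is already at most 1/o_m^4. *)
  destruct (tauc_lim d c 1 gam (if Nat.eqb (a 0%nat) 0 then RtoC 1 else RtoC 0) hc hc1)
    as [L HL].
  - lra.
  - intros i m Hi Hm. rewrite Eg by exact Hm. unfold Rdiv; rewrite Rmult_1_l.
    apply inv_odd2_pow_le; [exact Hm|lia].
  - destruct (Nat.eqb (a 0%nat) 0); rewrite ?Cmod_0, ?Cmod_1; lra.
  - intros m Hm. unfold Rdiv; rewrite Rmult_1_l.
    destruct (Nat.eqb_spec (a 0%nat) 0) as [E|E].
    + unfold gam. rewrite E. cbn [Nat.mul Nat.add].
      replace (RtoC (/ odd2 m ^ 2) * RtoC 1 - RtoC 1 * RtoC (/ odd2 m ^ 2))%C
        with (RtoC 0) by ring.
      rewrite Cmod_0. left; now apply inv_odd2_pow_pos.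
    + replace (gam 0%nat m - RtoC 0 * RtoC (/ odd2 m ^ 2))%C with (gam 0%nat m) by ring.
      rewrite Eg by exact Hm. apply inv_odd2_pow_le; [exact Hm|lia].
  - pose proof (bco_toeplitz _ _ HL) as H.
    assert (HS : Clim (fun n => RtoC (starsum n (Gidx d c a))) (RtoC (4 / PI) * L)%C).
    { refine (Clim_ext_from 1 _ _ _ _ H). intros n Hn. cbn beta.
      refine (eq_trans (eq_sym (starsum_tauc d c a (fun _ => RtoC 1) n hc Hn)) _).
      rewrite prodC0_prodfrom.
      assert (E : forall n i, prodfrom (fun _ => RtoC 1) i n = RtoC 1).
      { clear; intros n; induction n as [|n IH]; intros i; cbn [prodfrom]; [reflexivity|].
        rewrite IH; ring. }
      rewrite E; ring. }
    set (l := fst (RtoC (4 / PI) * L)%C).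
    assert (Hl : is_lim_seq (fun n => starsum n (Gidx d c a)) l).
    { apply is_lim_seq_spec. intros eps. destruct (HS eps (cond_pos eps)) as [N HN].
      exists N. intros n Hn. eapply Rle_lt_trans; [|exact (HN n Hn)].
      eapply Rle_trans; [|apply Rmax_Cmod]. apply Rmax_l. }
    apply Clim_RtoC. unfold tstar. rewrite (is_lim_seq_unique _ _ Hl). exact Hl.
Qed.

Definition gpow (z : nat -> C) (i a m : nat) : C :=
  (RtoC (/ odd2 m ^ (2 * a + 2)) * Defs.Cpow (z i) (2 * a))%C.

Definition gN (z : nat -> C) (N i m : nat) : C := sumC0 N (fun a => gpow z i a m).

Definition ginf (z : nat -> C) (i m : nat) : C :=
  (/ (RtoC (odd2 m ^ 2) - Defs.Cpow (z i) 2))%C.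

(** For fixed N the box is finite, so one sequence in n has both sides as limits: termwise it tends
    to the box sum of t-star values, and with the box summed inside the nested sum [bco_toeplitz]
    applies. *)
Lemma Gpartial_eq (d : nat) (c : nat -> nat) (z : nat -> C) (N : nat) (X : C) :
  (forall i, (1 <= i <= d)%nat -> (1 <= c i)%nat /\ c i <> 2%nat) ->
  ((1 <= d)%nat -> (3 <= c 1)%nat) ->
  Clim (fun K => sumC1 K (tauc d c (gN z N))) X ->
  Gpartial d c z N = (RtoC (4 / PI) * X)%C.
Proof.
  intros hc hc1 HX.
  apply (Clim_unique (fun n => boxsum N (S d) (fun l =>
    RtoC (starsum n (Gidx d c (fun i => nth i l 0%nat))) *
    prodC0 d (fun i => Defs.Cpow (z i) (2 * nth i l 0%nat)))%C)).
  - unfold Gpartial. apply Clim_boxsum. intros l. cbv zeta.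
    apply Clim_mult; [now apply tstar_lim|apply Clim_const].
  - refine (Clim_ext_from 1 _ _ _ _ (bco_toeplitz _ _ HX)). intros n Hn. cbn beta.
    rewrite (boxsum_ext N (S d) _ (fun l => sumC1 n (fun k => RtoC (bco n k) *
      tauc d c (fun j m => gpow z j (nth j l 0%nat) m) k)%C)).
    + rewrite (boxsum_sumC1 N (S d) n (fun k l => RtoC (bco n k) *
        tauc d c (fun j m => gpow z j (nth j l 0%nat) m) k)%C).
      apply sumC1_ext; intros k _. rewrite boxsum_scal, tauc_boxsum. reflexivity.
    + intros l. exact (starsum_tauc d c (fun i => nth i l 0%nat)
        (fun i => Defs.Cpow (z i) (2 * nth i l 0%nat)) n hc Hn).
Qed.

Lemma gpow_bound (z : nat -> C) (i a e m : nat) : (1 <= m)%nat -> (e <= 2 * a + 2)%nat ->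
  Cmod (gpow z i a m) <= / odd2 m ^ e * (Cmod (z i) ^ 2) ^ a.
Proof.
  intros Hm He. unfold gpow. rewrite Cmod_mult, Cmod_R, Cmod_Cpow, <- pow_mult.
  rewrite Rabs_pos_eq by (left; now apply inv_odd2_pow_pos).
  apply Rmult_le_compat_r; [apply pow_le, Cmod_ge_0|now apply inv_odd2_pow_le].
Qed.

Lemma geom_sum_bound (f : nat -> C) (B rho : R) (N : nat) : 0 <= rho < 1 -> 0 <= B ->
  (forall a, Cmod (f a) <= B * rho ^ a) -> Cmod (sumC0 N f) <= B / (1 - rho).
Proof.
  intros Hr HB H.
  apply Rle_trans with (B * (1 - rho ^ S N) / (1 - rho)).
  - induction N as [|N IH]; cbn [sumC0].
    + eapply Rle_trans; [apply H|]. right; simpl; field; lra.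
    + eapply Rle_trans; [apply Cmod_triangle|].
      eapply Rle_trans; [apply Rplus_le_compat; [exact IH|apply H]|].
      right; simpl; field; lra.
  - apply Rmult_le_compat_r; [left; apply Rinv_0_lt_compat; lra|].
    pose proof (pow_le rho (S N) ltac:(lra)). nra.
Qed.

Lemma sqr_lt1 (x : R) : 0 <= x < 1 -> 0 <= x ^ 2 < 1.
Proof. intros H; nra. Qed.

Lemma gN_bound (z : nat -> C) (N i m : nat) : Cmod (z i) < 1 -> (1 <= m)%nat ->
  Cmod (gN z N i m) <= / odd2 m ^ 2 / (1 - Cmod (z i) ^ 2).
Proof.
  intros Hz Hm. apply geom_sum_bound.
  - apply sqr_lt1; pose proof (Cmod_ge_0 (z i)); lra.
  - left; now apply inv_odd2_pow_pos.
  - intros a; apply gpow_bound; [exact Hm|lia].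
Qed.

Lemma gN_tail_bound (z : nat -> C) (N i m : nat) : Cmod (z i) < 1 -> (1 <= m)%nat ->
  Cmod (gN z N i m - RtoC 1 * RtoC (/ odd2 m ^ 2))%C <= / odd2 m ^ 4 / (1 - Cmod (z i) ^ 2).
Proof.
  intros Hz Hm. pose proof (Cmod_ge_0 (z i)) as Hz0.
  pose proof (inv_odd2_pow_pos m 4 Hm) as Ho.
  (* The subtracted term is the one with a = 0; all others have exponent at least 4, so the same
     geometric majorant works. *)
  set (f := fun a => match a with O => RtoC 0 | S _ => gpow z i a m end).
  replace (gN z N i m - RtoC 1 * RtoC (/ odd2 m ^ 2))%C with (sumC0 N f).
  - apply geom_sum_bound; [apply sqr_lt1; lra|lra|].
    intros [|a]; unfold f.
    + rewrite Cmod_0; simpl (_ ^ 0); lra.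
    + apply gpow_bound; [exact Hm|lia].
  - unfold gN. induction N as [|N IH]; cbn [sumC0].
    + unfold f, gpow. cbn [Nat.mul Nat.add Defs.Cpow]. ring.
    + rewrite IH. unfold f at 1. ring.
Qed.

Lemma ginf_den_neq0 (z : nat -> C) (i m : nat) : Cmod (z i) < 1 -> (1 <= m)%nat ->
  (RtoC (odd2 m ^ 2) - Defs.Cpow (z i) 2)%C <> RtoC 0.
Proof.
  intros Hz Hm E. pose proof (odd2_ge1 m Hm).
  assert (E' : Defs.Cpow (z i) 2 = RtoC (odd2 m ^ 2)).
  { replace (Defs.Cpow (z i) 2)
      with (RtoC (odd2 m ^ 2) - (RtoC (odd2 m ^ 2) - Defs.Cpow (z i) 2))%C by ring.
    rewrite E; ring. }
  apply (f_equal Cmod) in E'. rewrite Cmod_Cpow, Cmod_R, Rabs_pos_eq in E' by nra.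
  pose proof (sqr_lt1 (Cmod (z i)) (conj (Cmod_ge_0 _) Hz)). nra.
Qed.

Lemma gN_closed (z : nat -> C) (N i m : nat) : Cmod (z i) < 1 -> (1 <= m)%nat ->
  gN z N i m = (ginf z i m *
    (RtoC 1 - RtoC (/ odd2 m ^ (2 * N + 2)) * Defs.Cpow (z i) (2 * N + 2)))%C.
Proof.
  intros Hz Hm. pose proof (ginf_den_neq0 z i m Hz Hm) as HD.
  assert (Ho : RtoC (odd2 m ^ 2) <> RtoC 0).
  { intros E; apply RtoC_inj in E. revert E. apply pow_nonzero, odd2_neq0, Hm. }
  unfold gN, ginf. induction N as [|N IH]; cbn [sumC0].
  - unfold gpow. cbn [Nat.mul Nat.add].
    change (Defs.Cpow (z i) 0) with (RtoC 1).
    rewrite RtoC_inv by (apply pow_nonzero, odd2_neq0, Hm). field. split; assumption.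
  - rewrite IH. unfold gpow.
    replace (2 * S N)%nat with (2 * N + 2)%nat by lia.
    set (Z := Defs.Cpow (z i) (2 * N + 2)). rewrite (Cpow_add (z i) (2 * N + 2) 2). fold Z.
    set (W := Defs.Cpow (z i) 2) in *.
    replace (/ odd2 m ^ (2 * N + 2 + 2))
      with (/ odd2 m ^ (2 * N + 2) * / odd2 m ^ 2)
      by (rewrite (pow_add _ (2 * N + 2) 2), Rinv_mult; reflexivity).
    set (Q := / odd2 m ^ (2 * N + 2)).
    rewrite RtoC_mult, (RtoC_inv (odd2 m ^ 2)) by (apply pow_nonzero, odd2_neq0, Hm).
    field. split; assumption.
Qed.

Lemma gN_lim (z : nat -> C) (i m : nat) : Cmod (z i) < 1 -> (1 <= m)%nat ->
  Clim (fun N => gN z N i m) (ginf z i m).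
Proof.
  intros Hz Hm.
  assert (H0 : Clim (fun N => RtoC (/ odd2 m ^ (2 * N + 2)) * Defs.Cpow (z i) (2 * N + 2))%C
                    (RtoC 0)).
  { intros eps Heps.
    pose proof (sqr_lt1 (Cmod (z i)) (conj (Cmod_ge_0 _) Hz)) as Hs.
    destruct (pow_lt_1_zero (Cmod (z i) ^ 2)) with (y := eps) as [N HN];
      [rewrite Rabs_pos_eq; lra|exact Heps|].
    exists N. intros n Hn. specialize (HN (S n) ltac:(lia)).
    rewrite Rabs_pos_eq in HN by (apply pow_le; lra). rewrite <- pow_mult in HN.
    replace (RtoC (/ odd2 m ^ (2 * n + 2)) * Defs.Cpow (z i) (2 * n + 2) - RtoC 0)%C
      with (RtoC (/ odd2 m ^ (2 * n + 2)) * Defs.Cpow (z i) (2 * n + 2))%C by ring.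
    rewrite Cmod_mult, Cmod_R, Cmod_Cpow.
    replace (2 * S n)%nat with (2 * n + 2)%nat in HN by lia.
    pose proof (inv_odd2_pow_pos m (2 * n + 2) Hm) as P1.
    pose proof (inv_odd2_pow_le m 0 (2 * n + 2) Hm ltac:(lia)) as P2.
    simpl (odd2 m ^ 0) in P2. rewrite Rinv_1 in P2.
    rewrite Rabs_pos_eq by lra.
    pose proof (pow_le (Cmod (z i)) (2 * n + 2) (Cmod_ge_0 _)). nra. }
  replace (ginf z i m) with (ginf z i m * (RtoC 1 + RtoC (-1) * RtoC 0))%C by ring.
  refine (Clim_ext _ _ _ _ (Clim_mult _ _ _ _ (Clim_const (ginf z i m))
    (Clim_plus _ _ _ _ (Clim_const (RtoC 1))
      (Clim_mult _ _ _ _ (Clim_const (RtoC (-1))) H0)))).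
  intros N; cbn beta. rewrite gN_closed by assumption. ring.
Qed.

Lemma Clim_Tc (d : nat) (c : nat -> nat) (gam : nat -> nat -> nat -> C)
  (gl : nat -> nat -> C) :
  (forall i m, (i <= d)%nat -> (1 <= m)%nat -> Clim (fun N => gam N i m) (gl i m)) ->
  forall n i k, (i + n <= S d)%nat ->
  Clim (fun N => Tc d c (gam N) i n k) (Tc d c gl i n k).
Proof.
  intros H n; induction n as [|n IH]; intros i k Hi; cbn [Tc]; [apply Clim_const|].
  apply (Clim_sumC1 k (fun N m => RtoC (phi d c i m * Vc d c i k m) * gam N i m
                              * Tc d c (gam N) (S i) n m)%C).
  intros m Hm. apply Clim_mult; [|apply IH; lia].
  apply Clim_mult; [apply Clim_const|apply H; lia].
Qed.

Lemma factor_ginf (d : nat) (c : nat -> nat) (z : nat -> C) (i k m : nat) :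
  factor d c z i k m = (RtoC (phi d c i m * Vc d c i k m) * ginf z i m)%C.
Proof. unfold factor, phi, Vc, ginf, Cdiv. rewrite !RtoC_mult. ring. Qed.

Lemma Ch_factor (d : nat) (c : nat -> nat) (z : nat -> C) (n i k : nat) :
  Ch (factor d c z) i n k k = Tc d c (ginf z) i n k.
Proof.
  revert i k; induction n as [|n IH]; intros i k; cbn [Ch Tc]; [reflexivity|].
  apply sumC1_ext; intros m _. rewrite IH, factor_ginf; reflexivity.
Qed.

(** At level 0, c_0 = 1 gives [lam] = o_k, and k_(-1) = 0 gives V^# = 2 o_0/o_k = -2/o_k because o_0
    = -1. Their product -2 accounts for the sign in [tauc] and turns 2/pi into 4/pi. *)
Lemma RHSpartial_eq (d : nat) (c : nat -> nat) (z : nat -> C) (N : nat) :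
  RHSpartial d c z N = (RtoC (4 / PI) * sumC1 N (tauc d c (ginf z)))%C.
Proof.
  unfold RHSpartial.
  rewrite (chainsum_ext (S d) N _ (fun l => prodfrom (fun j => factor d c z j
    (match (j - 0)%nat with O => 0%nat | S i' => nth i' l 0%nat end)
    (nth (j - 0) l 0%nat)) 0 (S d))).
  2:{ intros l. rewrite prodC0_prodfrom. apply prodfrom_ext; intros j _.
      rewrite Nat.sub_0_r. reflexivity. }
  rewrite chainsum_prodfrom. cbn [Ch].
  rewrite <- !sumC1_scal. apply sumC1_ext; intros k Hk.
  rewrite Ch_factor, factor_ginf. unfold tauc.
  replace (phi d c 0 k * Vc d c 0 0 k) with (2 * - kap (cext d c 1) k).
  - replace (4 / PI) with (2 / PI * 2) by (unfold Rdiv; ring).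
    rewrite !RtoC_mult. ring.
  - unfold phi, deltai. rewrite kap_lam by lia.
    change (cext d c 0) with 1%nat. rewrite lam1.
    unfold Vc. change (cext d c 0) with 1%nat. cbn [Nat.sub repeat Vsharp].
    replace (tri 0 k) with 1%nat by (destruct k; [lia|reflexivity]).
    unfold odd2 at 2. simpl. field. apply odd2_neq0; lia.
Qed.

(** One constant for all levels; [1 <= A] lets it bound the leading coefficient [al] = 1 as well. *)
Lemma inv_one_minus_sqr_bounded (d : nat) (z : nat -> C) :
  (forall i, (i <= d)%nat -> Cmod (z i) < 1) ->
  exists A, 1 <= A /\ forall i, (i <= d)%nat -> / (1 - Cmod (z i) ^ 2) <= A.
Proof.
  induction d as [|d IH]; intros Hz.
  - exists (Rmax 1 (/ (1 - Cmod (z 0%nat) ^ 2))). split; [apply Rmax_l|].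
    intros i Hi; replace i with 0%nat by lia; apply Rmax_r.
  - destruct IH as [A [HA H]]; [intros; apply Hz; lia|].
    exists (Rmax A (/ (1 - Cmod (z (S d)) ^ 2))). split.
    + eapply Rle_trans; [exact HA|apply Rmax_l].
    + intros i Hi. destruct (Nat.eq_dec i (S d)) as [->|]; [apply Rmax_r|].
      eapply Rle_trans; [apply H; lia|apply Rmax_l].
Qed.

Theorem theorem3p1 (d : nat) (c : nat -> nat) (z : nat -> C)
  (hc : forall i, (1 <= i <= d)%nat -> (1 <= c i)%nat /\ c i <> 2%nat)
  (hc1 : (1 <= d)%nat -> (3 <= c 1)%nat)
  (hz : forall i, (i <= d)%nat -> (Cmod (z i) < 1)%R) :
  exists L : C,
    filterlim (Gpartial d c z) eventually (locally L) /\
    filterlim (RHSpartial d c z) eventually (locally L).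
Proof.
  destruct (inv_one_minus_sqr_bounded d z hz) as [A [HA1 HA]].
  assert (Hg : forall N, gam_bounded d A (gN z N)).
  { intros N i m Hi Hm. eapply Rle_trans; [apply gN_bound; [now apply hz|exact Hm]|].
    unfold Rdiv. rewrite Rmult_comm. apply Rmult_le_compat_r; [|now apply HA].
    left; now apply inv_odd2_pow_pos. }
  assert (Ht : forall N m, (1 <= m)%nat ->
    Cmod (gN z N 0 m - RtoC 1 * RtoC (/ odd2 m ^ 2))%C <= A / odd2 m ^ 4).
  { intros N m Hm. eapply Rle_trans; [apply gN_tail_bound; [apply hz; lia|exact Hm]|].
    unfold Rdiv. rewrite Rmult_comm. apply Rmult_le_compat_r; [|apply HA; lia].
    left; now apply inv_odd2_pow_pos. }
  assert (H1 : Cmod (RtoC 1) <= A) by (rewrite Cmod_1; exact HA1).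
  pose proof PI_RGT_0 as Hpi.
  assert (E4 : (RtoC (PI / 4) * RtoC (4 / PI) = RtoC 1)%C)
    by (rewrite <- RtoC_mult; f_equal; field; lra).
  (* [tauc_lim] yields a limit for each N separately; defining [X] from [Gpartial] avoids choosing
     one for every N. *)
  set (X := fun N => (RtoC (PI / 4) * Gpartial d c z N)%C).
  assert (HX : forall N, Clim (fun K => sumC1 K (tauc d c (gN z N))) (X N)).
  { intros N. destruct (tauc_lim d c A (gN z N) (RtoC 1)) as [Y HY]; auto; [lra|].
    unfold X. rewrite (Gpartial_eq d c z N Y) by assumption.
    rewrite Cmult_assoc, E4, Cmult_1_l. exact HY. }
  (* N truncates the geometric series and K the outermost index: K to infinity gives pi/4 times the
     partial sum of G, N to infinity gives pi/4 times the truncated right-hand side. *)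
  destruct (Clim_uniform_interchange (fun N K => sumC1 K (tauc d c (gN z N))) X
    (fun K => sumC1 K (tauc d c (ginf z)))) as [L [HL1 HL2]].
  - intros eps Heps.
    destruct (tauc_cauchy d c A eps hc hc1 ltac:(lra) Heps) as [K0 HK].
    exists K0. intros N n m. apply (HK (gN z N) (RtoC 1)); auto.
  - exact HX.
  - intros K. apply (Clim_sumC1 K (fun N k => tauc d c (gN z N) k)). intros k Hk.
    unfold tauc. apply Clim_mult.
    + apply Clim_mult; [apply Clim_const|]. apply gN_lim; [apply hz; lia|lia].
    + apply Clim_Tc; [|lia]. intros i m Hi Hm. apply gN_lim; [now apply hz|exact Hm].
  - exists (RtoC (4 / PI) * L)%C. split; apply Clim_filterlim.
    + refine (Clim_ext _ _ _ _ (Clim_mult _ _ _ _ (Clim_const (RtoC (4 / PI))) HL2)).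
      intros N. unfold X.
      rewrite Cmult_assoc, (Cmult_comm (RtoC (4 / PI))), E4, Cmult_1_l. reflexivity.
    + refine (Clim_ext _ _ _ _ (Clim_mult _ _ _ _ (Clim_const (RtoC (4 / PI))) HL1)).
      intros N. symmetry. apply RHSpartial_eq.
Qed.
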